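(* Let $k\ge1$ be an integer, let $\lambda_1,\dots,\lambda_k>0$, and let $0<\alpha\le1$. Let $\{D_f(t)\}_{t\ge0}$ be a Lévy subordinator with $\mathbb E(D_f^r(t))<\infty$ for all $r>0$, let $\{M^\alpha(t)\}_{t\ge0}$ be the generalized fractional counting process with rates $\lambda_1,\dots,\lambda_k$, independent of $D_f$, and let $\mathcal Z_f^\alpha(t)=M^\alpha(D_f(t))$. Suppose that $\mathbb E\left(D_f^{i\alpha}(t)\right)\sim k_it^{i\theta}$ as $t\to\infty$ for $i=1,2$, where $0<\theta<1$, $k_1>0$ and $k_2\ge k_1^2$. Then the process $\{\mathcal Z_f^\alpha(t)\}_{t\ge0}$ exhibits the long-range dependence (LRD) property.
   Context: The generalized counting process (GCP) with positive rates $\lambda_1,\dots,\lambda_k$ is the counting process $\{M(t)\}_{t\ge0}$ with $M(0)=0$ that performs $k$ kinds of jumps of amplitude $1,2,\dots,k$ with rates $\lambda_1,\dots,\lambda_k$, respectively; equivalently it is (in law) the process $M(t)=\sum_{j=1}^k jN_j(t)$, where $N_1,\dots,N_k$ are independent Poisson processes with intensities $\lambda_1,\dots,\lambda_k$. For $0<\alpha<1$, the stable subordinator $\{D_\alpha(t)\}_{t\ge0}$ is the non-decreasing Lévy process with $\mathbb E(e^{-sD_\alpha(t)})=e^{-ts^\alpha}$, $s>0$, and the inverse stable subordinator is $Y_\alpha(t)=\inf\{x\ge0:D_\alpha(x)>t\}$. The generalized fractional counting process (GFCP) is $M^\alpha(t)=M(Y_\alpha(t))$ (in law), with $M$ independent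 of $Y_\alpha$, for $0<\alpha<1$, and $M^1=M$. A Lévy subordinator $\{D_f(t)\}_{t\ge0}$ is a one-dimensional Lévy process with non-decreasing sample paths, $D_f(0)=0$ a.s., and $\mathbb E(e^{-sD_f(t)})=e^{-tf(s)}$, $s>0$, where $f(s)=\int_0^\infty(1-e^{-sx})\,\mu(\mathrm dx)$ is its Bernstein function and the non-negative Lévy measure $\mu$ satisfies $\mu([0,\infty))=\infty$ and $\int_0^\infty\min\{x,1\}\,\mu(\mathrm dx)<\infty$. The process $\mathcal Z_f^\alpha$ is called the TCGFCP-I. LRD property: let $s>0$ be fixed and let $\{X(t)\}_{t\ge0}$ be a stochastic process such that $\operatorname{Corr}(X(s),X(t))\sim c(s)t^{-\gamma}$ as $t\to\infty$ for some $c(s)>0$. The process has the LRD property if $\gamma\in(0,1)$. *)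

(* Defs.v *)
From HB Require Import structures.
From mathcomp Require Import all_boot all_order all_algebra.
From mathcomp Require Import all_classical all_reals all_analysis.

Set Implicit Arguments.
Unset Strict Implicit.
Unset Printing Implicit Defensive.

Import Order.TTheory GRing.Theory Num.Theory.
Import numFieldNormedType.Exports.

Local Open Scope classical_set_scope.
Local Open Scope ring_scope.

(* A real-valued process indexed by [0, +oo[ is a map X : R -> T -> R; only the
   variables X t with 0 <= t matter. *)

(* Lets f ~_(pinfty_nbhs R) g be written for t tending to +oo. *)
Canonical pinfty_filterType (R : realType) :=
  FilterType (pinfty_nbhs R) (@filter_filter _ _ (@proper_pinfty_nbhs R)).

Section processes.
Context {R : realType}.

(* Product rule for one event of each family. When every family contains the
   whole space this is mutual independence: subfamilies of indices are obtained
   by choosing setT at the other ones. *)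
Definition mutually_independent d (T : measurableType d) (P : probability T R)
    (n : nat) (F : 'I_n -> set (set T)) : Prop :=
  forall A : 'I_n -> set T, (forall i, F i (A i)) ->
    P (\bigcap_(i in [set: 'I_n]) A i) = (\prod_(i < n) P (A i))%E.

Definition sigma_process d (T : measurableType d) (X : R -> T -> R) :
    set (set T) :=
  <<s \bigcup_(t in [set t : R | 0 <= t]) g_sigma_algebra_preimage (X t) >>.

Definition independent_processes d (T : measurableType d)
    (P : probability T R) (X Y : R -> T -> R) : Prop :=
  forall A B : set T, sigma_process X A -> sigma_process Y B ->
    P (A `&` B) = (P A * P B)%E.

(* Equality in law of two processes, possibly on different probability spaces:
   same finite-dimensional distributions, tested on measurable rectangles. *)
Definition equal_in_law d (T : measurableType d) (P : probability T R)
    (X : R -> T -> R) d' (T' : measurableType d') (P' : probability T' R)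
    (X' : R -> T' -> R) : Prop :=
  forall (n : nat) (t : 'I_n -> R) (B : 'I_n -> set R),
    (forall i, 0 <= t i) -> (forall i, measurable (B i)) ->
    P (\bigcap_(i in [set: 'I_n]) (X (t i) @^-1` B i)) =
    P' (\bigcap_(i in [set: 'I_n]) (X' (t i) @^-1` B i)).

Definition time_change (T : Type) (X D : R -> T -> R) : R -> T -> R :=
  fun t w => X (D t w) w.

Definition independent_increments d (T : measurableType d)
    (P : probability T R) (X : R -> T -> R) : Prop :=
  forall (n : nat) (t : nat -> R), 0 <= t 0%N ->
    {homo t : i j / (i <= j)%N >-> i <= j} ->
    mutually_independent P (fun i : 'I_n =>
      g_sigma_algebra_preimage (X (t i.+1) \- X (t i))).

Definition stationary_increments d (T : measurableType d)
    (P : probability T R) (X : R -> T -> R) : Prop :=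
  forall (s h : R) (B : set R), 0 <= s -> 0 <= h -> measurable B ->
    P ((X (s + h) \- X s) @^-1` B) = P ((X h \- X 0) @^-1` B).

Record levy_process d (T : measurableType d) (P : probability T R)
    (X : R -> {RV P >-> R}) : Prop := LevyProcess {
  levy_start0 : {ae P, forall w, X 0 w = 0} ;
  levy_independent : independent_increments P (fun t => X t) ;
  levy_stationary : stationary_increments P (fun t => X t) ;
  levy_stochastically_continuous : forall t e : R, 0 <= t -> 0 < e ->
    P [set w | e <= `|X s w - X t w|]
      @[s --> within [set s : R | 0 <= s] (nbhs t)] --> 0%E }.

(* Non-negativity of every path (not merely almost surely, as follows from
   X 0 = 0 a.s.) makes the time change of a process indexed by [0, +oo[
   meaningful at every sample point. *)
Record subordinator d (T : measurableType d) (P : probability T R)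
    (f : R -> R) (X : R -> {RV P >-> R}) : Prop := Subordinator {
  subordinator_levy : levy_process X ;
  subordinator_ge0 : forall (t : R) (w : T), 0 <= t -> 0 <= X t w ;
  subordinator_nondecreasing : forall (s t : R) (w : T),
    0 <= s -> s <= t -> X s w <= X t w ;
  subordinator_laplace : forall s t : R, 0 < s -> 0 <= t ->
    'E_P[(fun w => expR (- s * X t w))%R]%E = (expR (- t * f s))%:E }.

Record levy_measure (mu : {measure set R -> \bar R}) : Prop := LevyMeasure {
  levy_measure_concentrated : mu `]-oo, 0]%classic = 0%E ;
  levy_measure_infinite : mu `[0, +oo[%classic = +oo%E ;
  levy_measure_integrable :
    (\int[mu]_(x in `]0%R, +oo[) (Num.min x 1)%:E < +oo)%E }.

Definition bernstein_function (mu : {measure set R -> \bar R}) (f : R -> R) :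
    Prop :=
  forall s : R, 0 < s ->
    ((f s)%:E = \int[mu]_(x in `]0%R, +oo[) (1 - expR (- s * x))%:E)%E.

Definition levy_subordinator d (T : measurableType d) (P : probability T R)
    (f : R -> R) (X : R -> {RV P >-> R}) : Prop :=
  subordinator f X /\
  exists mu : {measure set R -> \bar R},
    levy_measure mu /\ bernstein_function mu f.

Definition stable_subordinator d (T : measurableType d) (P : probability T R)
    (alpha : R) (X : R -> {RV P >-> R}) : Prop :=
  subordinator (fun s => s `^ alpha) X.

(* The set is non-empty almost surely for a stable subordinator; on the null
   set where it is empty, inf returns 0. *)
Definition inverse_process (T : Type) (X : R -> T -> R) : R -> T -> R :=
  fun t w => inf [set x : R | 0 <= x /\ t < X x w].

Record counting_process (T : Type) (X : R -> T -> R) : Prop :=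
  CountingProcess {
  counting_start0 : forall w, X 0 w = 0 ;
  counting_nat : forall (t : R) (w : T), 0 <= t -> exists n : nat, X t w = n%:R ;
  counting_nondecreasing : forall (s t : R) (w : T),
    0 <= s -> s <= t -> X s w <= X t w ;
  counting_right_continuous : forall (t : R) (w : T), 0 <= t ->
    X s w @[s --> t^'+] --> X t w }.

Record poisson_process d (T : measurableType d) (P : probability T R)
    (rate : R) (N : R -> {RV P >-> R}) : Prop := PoissonProcess {
  poisson_counting : counting_process (fun t => N t) ;
  poisson_independent : independent_increments P (fun t => N t) ;
  poisson_increments : forall (s t : R) (n : nat), 0 <= s -> s < t ->
    P ((N t \- N s) @^-1` [set n%:R]) =
    (poisson_pmf (rate * (t - s)) n)%:E }.

(* The index j : 'I_k carries the jumps of amplitude j.+1. *)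
Definition generalized_counting_process d (T : measurableType d)
    (P : probability T R) (k : nat) (lambda : 'I_k -> R)
    (M : R -> {RV P >-> R}) : Prop :=
  counting_process (fun t => M t) /\
  exists (d' : measure_display) (T' : measurableType d')
         (P' : probability T' R) (N : 'I_k -> R -> {RV P' >-> R}),
    [/\ forall j, poisson_process (lambda j) (N j),
        mutually_independent P' (fun j => sigma_process (fun t => N j t)) &
        equal_in_law P (fun t => M t)
          P' (fun t w => \sum_(j < k) j.+1%:R * N j t w)].

Definition generalized_fractional_counting_process d (T : measurableType d)
    (P : probability T R) (alpha : R) (k : nat) (lambda : 'I_k -> R)
    (X : R -> {RV P >-> R}) : Prop :=
  if alpha == 1 then generalized_counting_process lambda X
  else
    counting_process (fun t => X t) /\
    exists (d' : measure_display) (T' : measurableType d')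
           (P' : probability T' R) (M D : R -> {RV P' >-> R}),
      let Y := inverse_process (fun t => D t) in
      [/\ generalized_counting_process lambda M,
          stable_subordinator alpha D,
          independent_processes P' (fun t => M t) Y &
          equal_in_law P (fun t => X t) P' (time_change (fun t => M t) Y)].

Definition correlation d (T : measurableType d) (P : probability T R)
    (X Y : T -> R) : R :=
  fine (covariance P X Y) /
    (Num.sqrt (fine 'V_P[X]%E) * Num.sqrt (fine 'V_P[Y]%E)).

(* The exponent does not depend on the fixed time s. *)
Definition long_range_dependence d (T : measurableType d)
    (P : probability T R) (X : R -> T -> R) : Prop :=
  exists2 gamma : R, 0 < gamma < 1 &
    forall s : R, 0 < s -> exists2 c : R, 0 < c &
      (fun t : R => correlation P (X s) (X t)) ~_(pinfty_nbhs R)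
      (fun t : R => c * t `^ (- gamma)).

End processes.

(* Main.v *)
(* Conditioning on [D], the moments of [Z t = M (D t)] are integrals of those of
   [M], and the latter reduce in the same way to the moments of the inverse
   stable subordinator [Y]. By self-similarity [E(Y_u) = c u^a] and
   [E(Y_u^2) = b u^(2a)], with [c^2 < b] when [a < 1]. Counting the points of a
   grid of mesh [h] before the passage times and letting [h] tend to [0], the
   renewal property gives, for [u <= v],
   [b/2 u^(2a) + c^2 u^a (v-u)^a <= E(Y_u Y_v) <= b/2 u^(2a) + c^2 u^a v^a],
   so that [Cov(Z_s, Z_t)] tends to a positive limit as [t] tends to infinity,
   because the increments of [t |-> E(D_t^a)] over a fixed length vanish. As
   [Var(Z_t)] grows like [t^(2 theta)], the correlation decays like
   [t^(- theta)]. *)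

Require Import Defs.
From HB Require Import structures.
From mathcomp Require Import all_boot all_order all_algebra.
From mathcomp Require Import ring lra.
From mathcomp Require Import all_classical all_reals all_analysis measurable_realfun.

Set Implicit Arguments.
Unset Strict Implicit.
Unset Printing Implicit Defensive.

Import Order.TTheory GRing.Theory Num.Theory.
Import numFieldNormedType.Exports.

Local Open Scope classical_set_scope.
Local Open Scope ring_scope.

(** * Joint laws *)

Section joint_laws.
Local Open Scope ereal_scope.
Context d1 d2 (T1 : measurableType d1) (T2 : measurableType d2) (R : realType).

(** The exact mixed moment of [Y] is an incomplete beta integral. The two-sided bound can replace it
    because its gap, a multiple of [v^a - (v-u)^a], tends to 0 as [v] grows when [a < 1]. To survive
    the substitution [u = D_s], [v = D_t], this difference is bounded by [e u + C exp(-v)] with [e]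
    arbitrarily small: the first term has a finite mean, and the second one has mean exactly
    [C exp(-t f(1))]. Self-similarity is obtained for the one-dimensional laws of the stable
    subordinator, by uniqueness of the Laplace transform; this suffices since two counts at the same
    level only involve nested events. The strict inequality [c^2 < b] keeps the leading coefficient
    of the variance, proportional to [b k2 - c^2 k1^2], positive even if [k2 = k1^2]. It fails for
    [a = 1], a case that the growth [t^theta] with [theta < 1] excludes, the mean of [D_t] being
    additive in [t]. *)

Lemma probability_prod_unique (m1 m2 : {measure set (T1 * T2) -> \bar R}) :
  m1 setT < +oo ->
  (forall A B, measurable A -> measurable B -> m1 (A `*` B) = m2 (A `*` B)) ->
  forall C, measurable C -> m1 C = m2 C.
Proof.
move=> m1T m12 C mC.
pose G : set (set (T1 * T2)) :=
  [set C | exists A, measurable A /\ exists B, measurable B /\ C = A `*` B].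
apply: (measure_unique G (fun=> setT)) => //.
- rewrite measurable_prod_measurableType //; congr (<<s _ >>).
  rewrite predeqE => D; split => [[A mA [B mB <-]]|[A [mA [B [mB ->]]]]].
    by exists A; split => //; exists B.
  by exists A => //; exists B.
- move=> _ _ [A1 [mA1 [B1 [mB1 ->]]]] [A2 [mA2 [B2 [mB2 ->]]]].
  rewrite -setXI; exists (A1 `&` A2); split; first exact: measurableI.
  by exists (B1 `&` B2); split => //; exact: measurableI.
- move=> _; exists setT; split; first exact: measurableT.
  by exists setT; split; [exact: measurableT|rewrite setXTT].
- by rewrite bigcup_const.
- by move=> _ [A [mA [B [mB ->]]]]; exact: m12.
Qed.

Lemma integral_pair_eq d (T : measurableType d) (P : probability T R)
    d' (T' : measurableType d') (P' : probability T' R)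
    (X : T -> T1) (Y : T -> T2) (X' : T' -> T1) (Y' : T' -> T2)
    (f : T1 * T2 -> \bar R) :
  measurable_fun setT X -> measurable_fun setT Y ->
  measurable_fun setT X' -> measurable_fun setT Y' ->
  (forall A B, measurable A -> measurable B ->
    P (X @^-1` A `&` Y @^-1` B) = P' (X' @^-1` A `&` Y' @^-1` B)) ->
  measurable_fun [set: T1 * T2] f -> (forall z, 0 <= f z) ->
  \int[P]_w f (X w, Y w) = \int[P']_w f (X' w, Y' w).
Proof.
move=> mX mY mX' mY' PP' mf f0.
have mXY : measurable_fun setT (fun w => (X w, Y w)) by exact: measurable_fun_pair.
have mXY' : measurable_fun setT (fun w => (X' w, Y' w)) by exact: measurable_fun_pair.
pose Z : {mfun T >-> (T1 * T2)%type} :=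
  HB.pack (fun w => (X w, Y w)) (isMeasurableFun.Build _ _ _ _ _ mXY).
pose Z' : {mfun T' >-> (T1 * T2)%type} :=
  HB.pack (fun w => (X' w, Y' w)) (isMeasurableFun.Build _ _ _ _ _ mXY').
rewrite -[LHS](@ge0_integral_distribution _ _ _ _ _ P Z f)//.
rewrite -[RHS](@ge0_integral_distribution _ _ _ _ _ P' Z' f)//.
apply: eq_measure_integral => A mA _.
apply: probability_prod_unique => //.
  by rewrite [X in X < _](@probability_setT _ _ _ (distribution P Z)) ltry.
Qed.

(** The joint law is the product of the marginal laws, and Tonelli applies. The targets are
    arbitrary measurable spaces because [X] and [Y] will both be the identity of the sample space,
    seen with the sigma-algebras generated by two processes. *)
Lemma integral_pair_indep d (T : measurableType d) (P : probability T R)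
    (X : T -> T1) (Y : T -> T2) (f : T1 * T2 -> \bar R) :
  measurable_fun setT X -> measurable_fun setT Y ->
  (forall A B, measurable A -> measurable B ->
    P (X @^-1` A `&` Y @^-1` B) = P (X @^-1` A) * P (Y @^-1` B)) ->
  measurable_fun [set: T1 * T2] f -> (forall z, 0 <= f z) ->
  \int[P]_w f (X w, Y w) = \int[P]_w2 \int[P]_w1 f (X w1, Y w2).
Proof.
move=> mX mY indep mf f0.
have mXY : measurable_fun setT (fun w => (X w, Y w)) by exact: measurable_fun_pair.
pose Z : {mfun T >-> (T1 * T2)%type} :=
  HB.pack (fun w => (X w, Y w)) (isMeasurableFun.Build _ _ _ _ _ mXY).
pose X1 : {mfun T >-> T1} := HB.pack X (isMeasurableFun.Build _ _ _ _ _ mX).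
pose Y1 : {mfun T >-> T2} := HB.pack Y (isMeasurableFun.Build _ _ _ _ _ mY).
rewrite -[LHS](@ge0_integral_distribution _ _ _ _ _ P Z f)//.
transitivity (\int[distribution P X1 \x distribution P Y1]_z f z).
  apply: eq_measure_integral => A mA _.
  by apply/esym/product_measure_unique => // B C mB mC; exact: indep.
rewrite fubini_tonelli2//.
rewrite (@ge0_integral_distribution _ _ _ _ _ P Y1)//; last 2 first.
- exact: measurable_fun_fubini_tonelli_G.
- by move=> y; apply: integral_ge0 => x _.
apply: eq_integral => w _ /=.
rewrite /fubini_G (@ge0_integral_distribution _ _ _ _ _ P X1)//.
exact/measurableT_comp.
Qed.

End joint_laws.

(** * Time changes *)

Section time_change.
Context {R : realType}.

(** The successor puts the grid point strictly above [u], as a limit from the right requires; the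
    absolute value keeps every sampled index nonnegative. *)
Definition grid_above (n : nat) (u : R) : R :=
  (Num.truncn (`|u| * n.+1%:R)).+1%:R / n.+1%:R.

Lemma grid_above_gt n u : `|u| < grid_above n u.
Proof. by rewrite ltr_pdivlMr// truncnS_gt. Qed.

Lemma grid_above_le n u : grid_above n u <= `|u| + n.+1%:R^-1.
Proof.
rewrite ler_pdivrMr// mulrDl mulVf// -[leLHS]natr1 lerD2r.
by rewrite truncn_le mulr_ge0.
Qed.

Lemma cvg_grid_above u : grid_above ^~ u @ \oo --> `|u|.
Proof.
apply: (@squeeze_cvgr _ _ _ _ (fun=> `|u|) (fun n => `|u| + n.+1%:R^-1)).
- by near=> n; rewrite ltW ?grid_above_gt// grid_above_le.
- exact: cvg_cst.
- rewrite -[X in _ --> X]addr0; apply: cvgD; first exact: cvg_cst.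
  exact: cvg_harmonic.
Unshelve. all: by end_near. Qed.

(** Sampling the index at the next grid point gives a function that is measurable on each of
    countably many strips, and right continuity recovers [X] as the pointwise limit. *)
Lemma measurable_right_continuous d (T : measurableType d) (X : R -> T -> R) :
  (forall t, 0 <= t -> measurable_fun setT (X t)) ->
  (forall t w, 0 <= t -> X s w @[s --> t^'+] --> X t w) ->
  measurable_fun setT (fun z : R * T => X `|z.1| z.2).
Proof.
move=> mX rcX.
apply: (@measurable_fun_cvg _ _ _ _
  (fun n (z : R * T) => X (grid_above n z.1) z.2)); last first.
  move=> [u w] _ /=; have /cvg_at_rightP := rcX `|u| w (normr_ge0 _); apply.
  split; [|exact: cvg_grid_above]. by move=> n; apply: grid_above_gt.
move=> n _ B mB; rewrite setTI.
pose S i : set R := [set u | Num.truncn (`|u| * n.+1%:R) = i].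
have mS i : measurable (S i).
  have -> : S i = (fun u : R => `|u| * n.+1%:R) @^-1` `[i%:R, i.+1%:R[.
    apply/seteqP; split => u /=; rewrite in_itv/= -truncn_eq ?mulr_ge0//.
      by move=> ->.
    by move/eqP.
  rewrite -[X in measurable X]setTI.
  have : measurable_fun setT (fun u : R => `|u| * n.+1%:R).
    by apply: measurable_funM => //; exact: measurableT_comp.
  by apply.
rewrite (_ : _ @^-1` B = \bigcup_i (S i `*` X (i.+1%:R / n.+1%:R) @^-1` B)).
  apply: bigcupT_measurable => i; apply: measurableX => //.
  by rewrite -[X in measurable X]setTI; apply: mX => //; exact: divr_ge0.
apply/seteqP; split => [[u w] /= Bz|[u w] [i _] [/= <-]//].
by exists (Num.truncn (`|u| * n.+1%:R)).
Qed.

Variables (d : measure_display) (T : measurableType d) (P : probability T R).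
Variables X D : R -> T -> R.
Hypothesis mX : forall t, 0 <= t -> measurable_fun setT (X t).
Hypothesis rcX : forall t w, 0 <= t -> X s w @[s --> t^'+] --> X t w.
Hypothesis mD : forall t, 0 <= t -> measurable_fun setT (D t).
Hypothesis D_ge0 : forall t w, 0 <= t -> 0 <= D t w.

Lemma measurable_time_change t : 0 <= t ->
  measurable_fun setT (time_change X D t).
Proof.
move=> t0; rewrite (_ : time_change X D t =
  (fun z : R * T => X `|z.1| z.2) \o (fun w => (D t w, w))).
  apply: measurableT_comp; first exact: measurable_right_continuous.
  by apply: measurable_fun_pair => //; exact: mD.
by apply/funext => w; rewrite /time_change/= ger0_norm// D_ge0.
Qed.

Lemma sigma_process_measurable (Y : R -> T -> R) :
  (forall t, 0 <= t -> measurable_fun setT (Y t)) ->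
  sigma_process Y `<=` measurable.
Proof.
move=> mY; apply: smallest_sub; first exact: sigma_algebra_measurable.
by move=> _ [t /= t0 [B mB <-]]; exact: mY.
Qed.

Lemma measurable_sigma_process (Y : R -> T -> R) t : 0 <= t ->
  measurable_fun setT (Y t : g_sigma_algebraType
    (\bigcup_(t in [set t : R | 0 <= t]) g_sigma_algebra_preimage (Y t)) -> R).
Proof.
by move=> t0 _ B mB; apply: sub_sigma_algebra; exists t => //; exists B.
Qed.

Hypothesis indep : independent_processes P X D.

(** Independence of the two processes is independence of the identity map towards [T1] and towards
    [T2], two copies of the sample space carrying the generated sigma-algebras. The integrand reads
    [X] on the first copy and [D] on the second one; it is measurable for the product by right
    continuity of [X]. *)
Lemma integral_time_change (h : R * R -> \bar R) (s t : R) :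
  0 <= s -> 0 <= t ->
  measurable_fun [set: R * R] h -> (forall z, 0 <= h z)%E ->
  (\int[P]_w h (time_change X D s w, time_change X D t w) =
   \int[P]_w2 \int[P]_w1 h (X (D s w2) w1, X (D t w2) w1))%E.
Proof.
move=> s0 t0 mh h0.
pose T1 := g_sigma_algebraType
  (\bigcup_(t in [set t : R | 0 <= t]) g_sigma_algebra_preimage (X t)).
pose T2 := g_sigma_algebraType
  (\bigcup_(t in [set t : R | 0 <= t]) g_sigma_algebra_preimage (D t)).
pose f (z : T1 * T2) := h (X `|D s z.2| z.1, X `|D t z.2| z.1).
have mXD r : 0 <= r -> measurable_fun setT (fun z : T1 * T2 => X `|D r z.2| z.1).
  move=> r0; pose g (z : T1 * T2) : R * T1 := (D r z.2, z.1).
  apply: (@measurableT_comp _ _ _ _ _ _ (fun z : R * T1 => X `|z.1| z.2) _ g).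
    by apply: measurable_right_continuous => // *; exact: measurable_sigma_process.
  apply: measurable_fun_pair => //.
  by apply: measurableT_comp => //; exact: measurable_sigma_process.
have mf : measurable_fun setT f.
  by apply: measurableT_comp => //; apply: measurable_fun_pair; exact: mXD.
have id1 : measurable_fun setT (id : T -> T1).
  by move=> _ A; rewrite setTI; exact: sigma_process_measurable.
have id2 : measurable_fun setT (id : T -> T2).
  by move=> _ A; rewrite setTI; exact: sigma_process_measurable.
have := @integral_pair_indep _ _ T1 T2 R _ T P id id f id1 id2 indep mf.
rewrite /f /= => /(_ (fun=> h0 _)).
under eq_integral do rewrite !ger0_norm ?D_ge0//.
move=> ->; apply: eq_integral => w2 _; apply: eq_integral => w1 _.
by rewrite !ger0_norm ?D_ge0.
Qed.

End time_change.

(** * Poisson variables and processes *)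

Section counting_moments.
Local Open Scope ereal_scope.
Context {R : realType}.

Lemma nneseriesS (f : nat -> \bar R) : (forall n, 0 <= f n) ->
  \sum_(n <oo) f n = f 0%N + \sum_(n <oo) f n.+1.
Proof.
move=> f0; rewrite nneseries_recl//; congr (_ + _).
rewrite -(@nneseries_addn _ _ 1)//.
by apply: eq_eseriesr => n _; rewrite addn1.
Qed.

Lemma integral_nat_valued d (T : measurableType d) (P : probability T R)
    (X : T -> R) (h : R -> \bar R) :
  measurable_fun setT X -> (forall w, exists n : nat, X w = n%:R) ->
  measurable_fun setT h -> (forall x, 0 <= h x) ->
  \int[P]_w h (X w) = \sum_(n <oo) (h n%:R * P (X @^-1` [set n%:R])).
Proof.
move=> mX natX mh h0.
have mF n : measurable (X @^-1` [set n%:R]) by rewrite -[X in measurable X]setTI; exact: mX.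
have -> : setT = \bigcup_n (X @^-1` [set n%:R]).
  by apply/seteqP; split => // w _; have [n Xn] := natX w; exists n.
rewrite ge0_integral_bigcup//; last 2 first.
- by apply: measurable_funTS; exact: measurableT_comp.
- apply/trivIsetP => i j _ _ ij; apply/seteqP; split => // w [/= ->] /eqP.
  by rewrite eqr_nat (negbTE ij).
apply: eq_eseriesr => n _; rewrite (eq_integral (cst (h n%:R))) ?integral_cst//.
by move=> w /[!inE]/= ->.
Qed.

Section poisson_variable.
Context d (T : measurableType d) (P : probability T R) (X : T -> R) (r : R).
Hypothesis mX : measurable_fun setT X.
Hypothesis natX : forall w, exists n : nat, X w = n%:R.
Hypothesis r_gt0 : (0 < r)%R.
Hypothesis poissonX : forall n, P (X @^-1` [set n%:R]) = (poisson_pmf r n)%:E.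

Lemma poisson_pmfS n : (n.+1%:R * poisson_pmf r n.+1 = r * poisson_pmf r n)%R.
Proof.
rewrite /poisson_pmf r_gt0 factS natrM invfM exprS.
have n0 : n.+1%:R != 0%R :> R by rewrite pnatr_eq0.
by rewrite -!mulrA mulrCA; congr (_ * _)%R; rewrite mulrCA mulVKf.
Qed.

Lemma poisson_pmf_sum : \sum_(n <oo) (poisson_pmf r n)%:E = 1.
Proof.
have := @integral_nat_valued _ _ P X (cst 1) mX natX (measurable_cst _) (fun=> @lee01 R).
have -> : \int[P]_w cst 1 (X w) = 1.
  by rewrite (integral_cst P measurableT 1) mul1e; exact: probability_setT.
by move=> ->; apply: eq_eseriesr => n _; rewrite mul1e poissonX.
Qed.

(** The Stein-Chen identity [E(N g(N)) = r E(g(N + 1))]; the choices [g = 1] and [g = id] give the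
    first two moments. *)
Lemma poisson_shift (g : nat -> R) : (forall n, 0 <= g n)%R ->
  \sum_(n <oo) (n%:R * g n * poisson_pmf r n)%:E =
  r%:E * \sum_(n <oo) (g n.+1 * poisson_pmf r n)%:E.
Proof.
move=> g0; rewrite nneseriesS; last first.
  by move=> n; rewrite lee_fin !mulr_ge0// poisson_pmf_ge0.
rewrite !mul0r add0e -nneseriesZl; last first.
  by move=> n; rewrite lee_fin !mulr_ge0// poisson_pmf_ge0.
apply: eq_eseriesr => n _; rewrite -EFinM; congr (_%:E).
by rewrite mulrAC poisson_pmfS mulrAC mulrA.
Qed.

Lemma poisson_mean : \int[P]_w (X w)%:E = r%:E.
Proof.
transitivity (\int[P]_w (`|X w|)%:E).
  apply: eq_integral => w _; have [n ->] := natX w.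
  by rewrite ger0_norm.
rewrite (@integral_nat_valued _ _ P X (fun x => `|x|%:E))//; last first.
  by apply/measurable_EFinP; exact: normr_measurable.
under eq_eseriesr => n _.
  rewrite poissonX -EFinM ger0_norm// -[X in (X * _)%R]mulr1; over.
rewrite (@poisson_shift (fun=> 1%R))//.
under eq_eseriesr do rewrite mul1r.
by rewrite poisson_pmf_sum mule1.
Qed.

Lemma poisson_second_moment : \int[P]_w (X w ^+ 2)%:E = (r + r ^+ 2)%:E.
Proof.
rewrite (@integral_nat_valued _ _ P X (fun x => (x ^+ 2)%:E))//; last 2 first.
- exact/measurable_EFinP.
- by move=> x; rewrite lee_fin sqr_ge0.
under eq_eseriesr do rewrite poissonX -EFinM expr2.
rewrite (@poisson_shift (fun n => n%:R))//.
under eq_eseriesr do rewrite -natr1 mulrDl mul1r EFinD.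
rewrite nneseriesD; last 2 first.
- by move=> n _ _; rewrite lee_fin mulr_ge0// poisson_pmf_ge0.
- by move=> n _ _; rewrite lee_fin poisson_pmf_ge0.
under eq_eseriesr do rewrite -[X in (X * _)%R]mulr1.
rewrite (@poisson_shift (fun=> 1%R))//.
under eq_eseriesr do rewrite mul1r.
by rewrite poisson_pmf_sum mule1 -EFinD -EFinM; congr (_%:E); ring.
Qed.

End poisson_variable.
End counting_moments.

(** * Pairs of independent variables and two-dimensional marginals *)

Section increments.
Local Open Scope ereal_scope.
Context {R : realType} d (T : measurableType d) (P : probability T R).

Lemma integralM_indep (X Y : T -> R) :
  measurable_fun setT X -> measurable_fun setT Y ->
  (forall w, 0 <= X w)%R -> (forall w, 0 <= Y w)%R ->
  (forall A B, measurable A -> measurable B ->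
    P (X @^-1` A `&` Y @^-1` B) = P (X @^-1` A) * P (Y @^-1` B)) ->
  \int[P]_w (X w * Y w)%:E = \int[P]_w (X w)%:E * \int[P]_w (Y w)%:E.
Proof.
move=> mX mY X0 Y0 indep.
transitivity (\int[P]_w (`|X w| * `|Y w|)%:E).
  by apply: eq_integral => w _; rewrite !ger0_norm.
rewrite (@integral_pair_indep _ _ _ _ _ _ _ P X Y (fun z => (`|z.1| * `|z.2|)%:E))//=.
- have XY w : \int[P]_w1 (`|X w1| * `|Y w|)%:E = (Y w)%:E * \int[P]_w1 (X w1)%:E.
    rewrite -ge0_integralZl//.
    + by apply: eq_integral => w1 _; rewrite !ger0_norm// -EFinM mulrC.
    + exact/measurable_EFinP.
    + by move=> ? _; rewrite lee_fin.
    + by rewrite lee_fin.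
  under eq_integral do rewrite XY.
  rewrite ge0_integralZr//; first by rewrite muleC.
    exact/measurable_EFinP.
    by move=> ? _; rewrite lee_fin.
  by apply: integral_ge0 => ? _; rewrite lee_fin.
- apply/measurable_EFinP; apply: measurable_funM; exact: measurableT_comp.
Qed.

Lemma independent_increments2 (X : R -> T -> R) (s t : R) (A B : set R) :
  independent_increments P X -> (0 <= s)%R -> (s <= t)%R ->
  measurable A -> measurable B ->
  P ((X s \- X 0%R)%R @^-1` A `&` (X t \- X s)%R @^-1` B) =
  P ((X s \- X 0%R)%R @^-1` A) * P ((X t \- X s)%R @^-1` B).
Proof.
move=> indX s0 st mA mB.
(* Times are indexed by all naturals, so that [0, s, t] is continued by the constant [t]; only the
   first two increments are used. *)
pose u (n : nat) : R := if n is n'.+1 then if n' is _.+1 then t else s else 0%R.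
have u_homo : {homo u : i j / (i <= j)%N >-> (i <= j)%R}.
  by move=> [|[|i]] [|[|j]]//= _; exact: le_trans st.
pose C (i : 'I_2) : set T := if i == ord0 then (X s \- X 0%R)%R @^-1` A
  else (X t \- X s)%R @^-1` B.
have capC : \bigcap_(i in [set: 'I_2]) C i =
    (X s \- X 0%R)%R @^-1` A `&` (X t \- X s)%R @^-1` B.
  apply/seteqP; split => [w Cw|w [wA wB] i _]; rewrite /C.
    by split; [exact: (Cw ord0)|exact: (Cw (lift ord0 ord0))].
  by case: ifPn.
rewrite -capC (indX 2%N u (lexx _) u_homo C).
  by rewrite big_ord_recl big_ord1 /C.
move=> i; rewrite /C; case: i => -[|[|//]] /= i2.
  by exists A; rewrite ?setTI.
by exists B; rewrite ?setTI.
Qed.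

Lemma equal_in_law2 d' (T' : measurableType d') (P' : probability T' R)
    (X : R -> T -> R) (X' : R -> T' -> R) (s t : R) (A B : set R) :
  equal_in_law P X P' X' -> (0 <= s)%R -> (0 <= t)%R ->
  measurable A -> measurable B ->
  P (X s @^-1` A `&` X t @^-1` B) = P' (X' s @^-1` A `&` X' t @^-1` B).
Proof.
move=> XX' s0 t0 mA mB.
pose u (i : 'I_2) := if i == ord0 then s else t.
pose C (i : 'I_2) := if i == ord0 then A else B.
have capE (U : Type) (Y : R -> U -> R) : \bigcap_(i in [set: 'I_2]) (Y (u i) @^-1` C i) =
    Y s @^-1` A `&` Y t @^-1` B.
  apply/seteqP; split => [w Cw|w [wA wB] i _]; rewrite /C /u.
    by split; [exact: (Cw ord0)|exact: (Cw (lift ord0 ord0))].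
  by case: ifPn.
by rewrite -!capE; apply: XX' => i; rewrite /u /C; case: ifPn.
Qed.

Lemma equal_in_law_integral2 d' (T' : measurableType d') (P' : probability T' R)
    (X : R -> T -> R) (X' : R -> T' -> R) (s t : R) (h : R * R -> \bar R) :
  equal_in_law P X P' X' -> (0 <= s)%R -> (0 <= t)%R ->
  (forall t, (0 <= t)%R -> measurable_fun setT (X t)) ->
  (forall t, (0 <= t)%R -> measurable_fun setT (X' t)) ->
  measurable_fun [set: R * R] h -> (forall z, 0 <= h z) ->
  \int[P]_w h (X s w, X t w) = \int[P']_w h (X' s w, X' t w).
Proof.
move=> XX' s0 t0 mX mX' mh h0; apply: integral_pair_eq => //; try by [apply: mX|apply: mX'].
by move=> A B mA mB; exact: equal_in_law2.
Qed.

End increments.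

Section poisson_moments.
Local Open Scope ereal_scope.
Context {R : realType} d (T : measurableType d) (P : probability T R).
Variables (rate : R) (N : R -> {RV P >-> R}).
Hypotheses (rate_gt0 : (0 < rate)%R) (poissonN : poisson_process rate N).

Let N_ge0 t w : (0 <= t)%R -> (0 <= N t w)%R.
Proof. by move=> /(counting_nat (poisson_counting poissonN) w)[n ->]. Qed.

Let N_le s t w : (0 <= s)%R -> (s <= t)%R -> (N s w <= N t w)%R.
Proof. exact: (counting_nondecreasing (poisson_counting poissonN)). Qed.

Let N0 w : N 0%R w = 0%R.
Proof. exact: (counting_start0 (poisson_counting poissonN)). Qed.

Let nat_increment s t w : (0 <= s)%R -> (s <= t)%R ->
  exists n : nat, (N t w - N s w)%R = n%:R.
Proof.
move=> s0 st; have := N_le w s0 st.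
have [m ->] := counting_nat (poisson_counting poissonN) w s0.
have [n ->] := counting_nat (poisson_counting poissonN) w (le_trans s0 st).
by rewrite ler_nat => mn; exists (n - m)%N; rewrite natrB.
Qed.

Let measurable_increment s t : measurable_fun setT (N t \- N s)%R.
Proof. exact: measurable_funB. Qed.

Lemma poisson_increment_mean s t : (0 <= s)%R -> (s <= t)%R ->
  \int[P]_w (N t w - N s w)%:E = (rate * (t - s))%:E.
Proof.
move=> s0; rewrite le_eqVlt => /predU1P[->|st].
  by under eq_integral do rewrite subrr; rewrite integral0 subrr mulr0.
apply: (@poisson_mean _ _ _ P (N t \- N s)%R) => //.
- by move=> w; apply: nat_increment => //; exact: ltW.
- by rewrite mulr_gt0// subr_gt0.
- by move=> n; exact: (poisson_increments poissonN).
Qed.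

Lemma poisson_increment_second_moment s t : (0 <= s)%R -> (s <= t)%R ->
  \int[P]_w ((N t w - N s w) ^+ 2)%:E = (rate * (t - s) + (rate * (t - s)) ^+ 2)%:E.
Proof.
move=> s0; rewrite le_eqVlt => /predU1P[->|st].
  under eq_integral do rewrite subrr expr0n.
  by rewrite integral0 subrr mulr0 expr0n addr0.
apply: (@poisson_second_moment _ _ _ P (N t \- N s)%R) => //.
- by move=> w; apply: nat_increment => //; exact: ltW.
- by rewrite mulr_gt0// subr_gt0.
- by move=> n; exact: (poisson_increments poissonN).
Qed.

Lemma poisson_process_mean t : (0 <= t)%R ->
  \int[P]_w (N t w)%:E = (rate * t)%:E.
Proof.
move=> t0; rewrite -[in RHS](subr0 t) -poisson_increment_mean//.
by apply: eq_integral => w _; rewrite N0 subr0.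
Qed.

Lemma poisson_process_mixed_moment s t : (0 <= s)%R -> (s <= t)%R ->
  \int[P]_w (N s w * N t w)%:E = (rate ^+ 2 * s * t + rate * s)%:E.
Proof.
move=> s0 st.
(* [N s] is written as [N s - N 0], an increment, so that independence of increments applies to the
   product. *)
have E w : (N s w * N t w)%:E =
    ((N s w - N 0%R w) * (N t w - N s w))%:E + ((N s w - N 0%R w) ^+ 2)%:E.
  by rewrite N0 subr0 -EFinD; congr (_%:E); ring.
under eq_integral do rewrite E.
rewrite ge0_integralD//; last 4 first.
- by move=> w _; rewrite lee_fin mulr_ge0// subr_ge0 N_le.
- by apply/measurable_EFinP; apply: measurable_funM; exact: measurable_increment.
- by move=> w _; rewrite lee_fin sqr_ge0.
- by apply/measurable_EFinP; apply: measurable_funX; exact: measurable_increment.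
rewrite (@integralM_indep _ _ _ P (N s \- N 0%R)%R (N t \- N s)%R)//; last 3 first.
- by move=> w; rewrite subr_ge0 N_le.
- by move=> w; rewrite subr_ge0 N_le.
- move=> A B mA mB; apply: (@independent_increments2 _ _ _ _ (fun t => N t)) => //.
  exact: (poisson_independent poissonN).
rewrite !poisson_increment_mean// poisson_increment_second_moment//.
by rewrite subr0 -EFinM -EFinD; congr (_%:E); ring.
Qed.

End poisson_moments.

(** * Generalized counting processes *)

Section generalized_counting_process_moments.
Local Open Scope ereal_scope.
Context {R : realType} (k : nat) (lambda : 'I_k -> R).
Hypothesis lambda_gt0 : forall j, (0 < lambda j)%R.

(** The [r]-th moment of the jump measure: [r = 1] gives the mean per unit of time and [r = 2] the
    variance per unit of time. *)
Definition jump_moment (r : nat) : R := \sum_(j < k) j.+1%:R ^+ r * lambda j.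

Lemma jump_moment_gt0 r : (0 < k)%N -> (0 < jump_moment r)%R.
Proof.
move=> k0; rewrite /jump_moment (bigD1 (Ordinal k0))//= ltr_pwDl//.
  by rewrite mulr_gt0// exprn_gt0.
by apply: sumr_ge0 => j _; rewrite mulr_ge0// ?exprn_ge0// ltW.
Qed.

Lemma mutually_independent2 d (T : measurableType d) (P : probability T R)
    (n : nat) (F : 'I_n -> set (set T)) (i j : 'I_n) (A B : set T) :
  mutually_independent P F -> (forall l, F l setT) -> i != j -> F i A -> F j B ->
  P (A `&` B) = P A * P B.
Proof.
move=> indF FT ij FA FB.
pose C l := if l == i then A else if l == j then B else setT.
have Ci : C i = A by rewrite /C eqxx.
have Cj : C j = B by rewrite /C eq_sym (negbTE ij) eqxx.
have capC : \bigcap_(l in [set: 'I_n]) C l = A `&` B.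
  apply/seteqP; split => [w Cw|w [wA wB] l _].
    by split; [rewrite -Ci; exact: Cw|rewrite -Cj; exact: Cw].
  by rewrite /C; case: ifPn => // _; case: ifPn.
rewrite -capC indF; last first.
  by move=> l; rewrite /C; case: eqP => [->//|_]; case: eqP => [->//|_].
rewrite (bigD1 i)//= (bigD1 j) 1?eq_sym//= Ci Cj big1 ?mule1//.
move=> l /andP[li lj]; rewrite /C (negbTE li) (negbTE lj).
exact: probability_setT.
Qed.

Section independent_poisson_processes.
Context d (T : measurableType d) (P : probability T R).
Variable N : 'I_k -> R -> {RV P >-> R}.
Hypothesis poissonN : forall j, poisson_process (lambda j) (N j).
Hypothesis indepN : mutually_independent P (fun j => sigma_process (fun t => N j t)).

Let N_ge0 j t w : (0 <= t)%R -> (0 <= N j t w)%R.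
Proof. by move=> /(counting_nat (poisson_counting (poissonN j)) w)[n ->]. Qed.

Let S t w : R := \sum_(j < k) j.+1%:R * N j t w.

Lemma measurable_weighted_sum t : measurable_fun setT (S t).
Proof. by apply: measurable_sum => j; exact: measurable_funM. Qed.

Lemma weighted_sum_mean t : (0 <= t)%R ->
  \int[P]_w (S t w)%:E = (jump_moment 1 * t)%:E.
Proof.
move=> t0; under eq_integral do rewrite /S -sumEFin.
rewrite ge0_integral_sum//; last 2 first.
- by move=> j; apply/measurable_EFinP; exact: measurable_funM.
- by move=> j w _; rewrite lee_fin mulr_ge0// N_ge0.
rewrite /jump_moment mulr_suml -sumEFin; apply: eq_bigr => j _.
under eq_integral do rewrite EFinM.
rewrite ge0_integralZl//.
- rewrite (poisson_process_mean (lambda_gt0 j) (poissonN j))//.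
  by rewrite -EFinM expr1 mulrA.
- exact/measurable_EFinP.
- by move=> w _; rewrite lee_fin N_ge0.
Qed.

Lemma poisson_cross_moment i j s t : (0 <= s)%R -> (s <= t)%R ->
  \int[P]_w (N i s w * N j t w)%:E =
  (lambda i * lambda j * s * t + (if i == j then lambda i * s else 0))%:E.
Proof.
move=> s0 st; have t0 := le_trans s0 st; case: eqP => [<-|/eqP ij].
  by rewrite (poisson_process_mixed_moment (lambda_gt0 i) (poissonN i)).
rewrite integralM_indep//; try by move=> w; exact: N_ge0.
  rewrite (poisson_process_mean (lambda_gt0 i) (poissonN i))//.
  rewrite (poisson_process_mean (lambda_gt0 j) (poissonN j))//.
  by rewrite -EFinM; congr (_%:E); ring.
move=> A B mA mB; apply: (mutually_independent2 indepN _ ij).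
- by move=> l; exact: (@measurableT _ (g_sigma_algebraType _)).
- by apply: sub_sigma_algebra; exists s => //; exists A; rewrite ?setTI.
- by apply: sub_sigma_algebra; exists t => //; exists B; rewrite ?setTI.
Qed.

(** In the double sum over amplitudes, the products of means contribute the square of
    [jump_moment 1]; only equal amplitudes add a covariance, whence [jump_moment 2]. *)
Lemma weighted_sum_mixed_moment s t : (0 <= s)%R -> (s <= t)%R ->
  \int[P]_w (S s w * S t w)%:E =
  (jump_moment 2 * s + jump_moment 1 ^+ 2 * s * t)%:E.
Proof.
move=> s0 st; have t0 := le_trans s0 st.
pose F (i j : 'I_k) w : R := (i.+1%:R * j.+1%:R * (N i s w * N j t w))%R.
have F_ge0 i j w : (0 <= F i j w)%R.
  by rewrite /F !mulr_ge0// N_ge0.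
have mF i j : measurable_fun setT (F i j).
  by apply: measurable_funM => //; exact: measurable_funM.
have -> : \int[P]_w (S s w * S t w)%:E =
    \int[P]_w (\sum_(i < k) \sum_(j < k) (F i j w)%:E).
  apply: eq_integral => w _; rewrite /S mulr_suml -sumEFin.
  apply: eq_bigr => i _; rewrite mulr_sumr -sumEFin.
  by apply: eq_bigr => j _; rewrite /F mulrACA.
rewrite ge0_integral_sum//; last 2 first.
- by move=> i; apply: emeasurable_sum => j; exact/measurable_EFinP.
- by move=> i w _; apply: sume_ge0 => j _; rewrite lee_fin.
transitivity (\sum_(i < k) \sum_(j < k) (i.+1%:R * j.+1%:R *
    (lambda i * lambda j * s * t + (if i == j then lambda i * s else 0)))%R%:E).
  apply: eq_bigr => i _; rewrite ge0_integral_sum//; last 2 first.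
  - by move=> j; exact/measurable_EFinP.
  - by move=> j w _; rewrite lee_fin.
  apply: eq_bigr => j _; rewrite /F.
  under eq_integral do rewrite EFinM.
  rewrite ge0_integralZl//.
  - by rewrite poisson_cross_moment// -EFinM.
  - by apply/measurable_EFinP; exact: measurable_funM.
  - by move=> w _; rewrite lee_fin mulr_ge0// N_ge0.
under eq_bigr do rewrite sumEFin.
rewrite sumEFin; congr (_%:E).
rewrite /jump_moment expr2 [X in (_ + X)%R](_ : _ =
    \sum_(i < k) \sum_(j < k) i.+1%:R * j.+1%:R * (lambda i * lambda j * s * t))%R; last first.
  rewrite !mulr_suml; apply: eq_bigr => i _; rewrite mulr_sumr !mulr_suml.
  by apply: eq_bigr => j _; rewrite !expr1; ring.
rewrite mulr_suml -big_split/=; apply: eq_bigr => i _.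
under eq_bigr do rewrite mulrDr.
rewrite big_split/= addrC; congr (_ + _)%R.
rewrite (bigD1 i)//= eqxx big1 ?addr0.
  by rewrite expr2 mulrA.
by move=> j ji; rewrite eq_sym (negbTE ji) mulr0.
Qed.

End independent_poisson_processes.

Context d (T : measurableType d) (P : probability T R) (M : R -> {RV P >-> R}).
Hypothesis hM : generalized_counting_process lambda M.

Lemma generalized_counting_process_mean t : (0 <= t)%R ->
  \int[P]_w (M t w)%:E = (jump_moment 1 * t)%:E.
Proof.
move=> t0; have [countM [d' [T' [P' [N [poissonN indepN lawM]]]]]] := hM.
(* Laws are transferred through functions that are nonnegative everywhere, hence the absolute value,
   which changes nothing on the nonnegative values taken by the processes. *)
pose h (z : R * R) := `|z.1|%:E.
have mh : measurable_fun setT h.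
  by apply/measurable_EFinP; apply: measurableT_comp => //; exact: normr_measurable.
have h0 z : 0 <= h z by rewrite lee_fin.
have mN r : (0 <= r)%R ->
    measurable_fun setT (fun w => \sum_(j < k) j.+1%:R * N j r w)%R.
  by move=> _; exact: measurable_weighted_sum.
have := equal_in_law_integral2 lawM t0 t0 (fun r _ => measurable_funPT (M r)) mN mh h0.
rewrite -(weighted_sum_mean poissonN t0) /h /= => H.
rewrite -[RHS](_ : \int[P']_w (`|\sum_(j < k) j.+1%:R * N j t w|%R)%:E = _).
  rewrite -H; apply: eq_integral => w _.
  by have [n ->] := counting_nat countM w t0; rewrite ger0_norm.
apply: eq_integral => w _; rewrite ger0_norm// sumr_ge0// => j _.
by have [n ->] := counting_nat (poisson_counting (poissonN j)) w t0; rewrite mulr_ge0.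
Qed.

Lemma generalized_counting_process_mixed_moment s t : (0 <= s)%R -> (0 <= t)%R ->
  \int[P]_w (M s w * M t w)%:E =
  (jump_moment 2 * Num.min s t + jump_moment 1 ^+ 2 * (s * t))%:E.
Proof.
wlog st : s t / (s <= t)%R.
  move=> H s0 t0; have [st|ts] := orP (le_total s t); first exact: H.
  rewrite minC [in RHS](mulrC s) -H//.
  by apply: eq_integral => w _; rewrite mulrC.
move=> s0 t0; have [countM [d' [T' [P' [N [poissonN indepN lawM]]]]]] := hM.
rewrite min_l// mulrA -(weighted_sum_mixed_moment poissonN indepN)//.
pose h (z : R * R) := (`|z.1 * z.2|)%:E.
have mh : measurable_fun setT h.
  apply/measurable_EFinP; apply: measurableT_comp; first exact: normr_measurable.
  exact: measurable_funM.
have h0 z : 0 <= h z by rewrite lee_fin.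
have mN r : (0 <= r)%R ->
    measurable_fun setT (fun w => \sum_(j < k) j.+1%:R * N j r w)%R.
  by move=> _; exact: measurable_weighted_sum.
have := equal_in_law_integral2 lawM s0 t0 (fun r _ => measurable_funPT (M r)) mN mh h0.
rewrite /h /= => H.
have N_ge0 r w : (0 <= r)%R -> (0 <= \sum_(j < k) j.+1%:R * N j r w)%R.
  move=> r0; rewrite sumr_ge0// => j _.
  by have [n ->] := counting_nat (poisson_counting (poissonN j)) w r0; rewrite mulr_ge0.
transitivity (\int[P]_w (`|M s w * M t w|%R)%:E).
  apply: eq_integral => w _; rewrite ger0_norm//.
  have [n ->] := counting_nat countM w t0.
  by have [m ->] := counting_nat countM w s0; rewrite mulr_ge0.
by rewrite H; apply: eq_integral => w _; rewrite ger0_norm// mulr_ge0// N_ge0.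
Qed.

End generalized_counting_process_moments.

(** * Laplace transforms *)

Section laplace_uniqueness.
Context {R : realType}.

Lemma bernoulli_expr (h : R) n : 0 <= h -> 1 + n%:R * h <= (1 + h) ^+ n.
Proof.
move=> h0; elim: n => [|n IH]; first by rewrite mul0r addr0 expr0.
rewrite exprS -natr1; apply: (@le_trans _ _ ((1 + h) * (1 + n%:R * h))).
  have : 0 <= n%:R * h ^+ 2 by rewrite mulr_ge0// sqr_ge0.
  by rewrite expr2; lra.
by rewrite ler_wpM2l// addr_ge0.
Qed.

Lemma bernoulli_onem_ge (y : R) n : 0 <= y <= 1 -> 1 - n%:R * y <= (1 - y) ^+ n.
Proof.
move=> /andP[y0 y1]; elim: n => [|n IH]; first by rewrite mul0r subr0 expr0.
have : y * (1 - y) ^+ n <= y * 1.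
  by rewrite ler_wpM2l// exprn_ile1 ?subr_ge0// lerBlDl lerDr.
by rewrite exprS -natr1; lra.
Qed.

Lemma bernoulli_onem_le (y : R) n : 0 <= y <= 1 -> (1 - y) ^+ n * (1 + n%:R * y) <= 1.
Proof.
move=> /andP[y0 y1]; elim: n => [|n IH]; first by rewrite mul0r addr0 expr0 mulr1.
apply: le_trans IH; rewrite exprSr -mulrA ler_wpM2l ?exprn_ge0 ?subr_ge0//.
have : 0 <= n.+1%:R * y ^+ 2 by rewrite mulr_ge0// sqr_ge0.
by rewrite expr2 -natr1; lra.
Qed.

(* Applied to [W = expR (- s X)], the left-hand side is a polynomial in the
   [expR (- n s X)], so that its mean only depends on the Laplace transform. The
   factor [n] in the exponent makes the limit [0] also at [W = 1 / 2]. *)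
Lemma cvg_threshold (W : R) : 0 < W <= 1 ->
  (fun n => (1 - W ^+ n.+1) ^+ (n.+1 * 2 ^ n.+1)) @ \oo --> (((W < 2^-1)%R)%:R : R).
Proof.
move=> /andP[W0 W1].
have W01 n : 0 <= W ^+ n <= 1 by rewrite exprn_ge0 ?exprn_ile1// ltW.
have c_le1 n : (1 - W ^+ n.+1) ^+ (n.+1 * 2 ^ n.+1) <= 1.
  by have /andP[? ?] := W01 n.+1; rewrite exprn_ile1 ?subr_ge0// lerBlDr lerDl.
have mE n : (n.+1 * 2 ^ n.+1)%:R * W ^+ n.+1 = n.+1%:R * (2 * W) ^+ n.+1.
  by rewrite natrM natrX -mulrA exprMn.
have [Wlt|Wge] := ltP W 2^-1; last first.
  (* For [y = W^(n+1)] and the exponent [N = (n+1) 2^(n+1)], the bound [(1 - y)^N <= 1 / (1 + N y)]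
     is at most [1 / (n+1)], because [N y = (n+1) (2 W)^(n+1) >= n+1]. *)
  apply: (@squeeze_cvgr _ _ _ _ (fun=> 0) (fun n => n.+1%:R^-1)).
  - near=> n; have /andP[? ?] := W01 n.+1; rewrite exprn_ge0 ?subr_ge0//=.
    have Wn : 1 <= (2 * W) ^+ n.+1 by rewrite exprn_ege1//; lra.
    have := bernoulli_onem_le (n.+1 * 2 ^ n.+1) (W01 n.+1); rewrite mE => H.
    rewrite -[leRHS]mul1r ler_pdivlMr//; apply: le_trans H.
    rewrite ler_wpM2l ?exprn_ge0 ?subr_ge0//.
    have : n.+1%:R * 1 <= n.+1%:R * (2 * W) ^+ n.+1 by rewrite ler_wpM2l.
    by lra.
  - exact: cvg_cst.
  - exact: cvg_harmonic.
(* The decay [(2 W)^n] is split into two factors [p^n]: one absorbs the factor [n], since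
   [n h <= (1 + h)^n = p^(-n)] by Bernoulli, and the other one tends to 0. *)
pose p := Num.sqrt (2 * W).
have p0 : 0 < p by rewrite sqrtr_gt0; lra.
have pp : p ^+ 2 = 2 * W by rewrite sqr_sqrtr//; lra.
have p1 : p < 1 by rewrite -(@ltr_pXn2r _ 2) ?nnegrE ?ltW// pp expr1n; lra.
pose h := p^-1 - 1.
have h0 : 0 < h by rewrite subr_gt0 invf_gt1.
apply: (@squeeze_cvgr _ _ _ _ (fun n => 1 - p ^+ n.+1 / h) (fun=> 1)).
- near=> n; rewrite c_le1 andbT.
  have := bernoulli_onem_ge (n.+1 * 2 ^ n.+1) (W01 n.+1); apply: le_trans.
  rewrite mE lerD2l lerN2 -pp -exprM mulnC exprM expr2 mulrA.
  rewrite mulrC ler_pM2l ?exprn_gt0//.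
  have h1 : 1 + h = p^-1 by rewrite /h addrC subrK.
  have := bernoulli_expr n.+1 (ltW h0); rewrite h1 exprVn => H.
  rewrite -[leRHS]mul1r ler_pdivlMr// mulrAC.
  have : n.+1%:R * h <= (p ^+ n.+1)^-1 by rewrite (le_trans _ H)// lerDr.
  by rewrite -[leRHS]mul1r ler_pdivlMr ?exprn_gt0.
- rewrite -[X in _ --> X]subr0; apply: cvgB; first exact: cvg_cst.
  rewrite -[X in _ --> X](mul0r h^-1); apply: cvgM; last exact: cvg_cst.
  have := @cvg_expr R p; rewrite ger0_norm ?(ltW p0)// => /(_ p1).
  by rewrite -(@cvg_shiftS _ (GRing.exp p)).
- exact: cvg_cst.
Unshelve. all: by end_near. Qed.

Section moments.
Local Open Scope ereal_scope.
Context d (T : measurableType d) (P : probability T R).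
Context d' (T' : measurableType d') (P' : probability T' R).
Variables (X : T -> R) (X' : T' -> R).
Hypotheses (mX : measurable_fun setT X) (mX' : measurable_fun setT X').
Hypotheses (X_ge0 : forall w, (0 <= X w)%R) (X'_ge0 : forall w, (0 <= X' w)%R).

Lemma integrable01 d0 (T0 : measurableType d0) (P0 : probability T0 R) (f : T0 -> R) :
  measurable_fun setT f -> (forall w, 0 <= f w <= 1)%R ->
  P0.-integrable setT (EFin \o f).
Proof.
move=> mf f01; apply: (@le_integrable _ _ _ _ _ _ _ (EFin \o cst 1%R)) => //.
- exact/measurable_EFinP.
- move=> w _ /=; rewrite lee_fin normr1 ger0_norm; by have /andP[] := f01 w.
- exact: finite_measure_integrable_cst.
Qed.

Hypothesis laplace : forall s : R, (0 < s)%R ->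
  \int[P]_w (expR (- s * X w))%:E = \int[P']_w (expR (- s * X' w))%:E.

(** The exponent [j] lets the induction on [m] close: expanding one factor [1 - expR (- a * X w)]
    trades it for one more power of the exponential. With no such factor left, the integral is the
    total mass or the Laplace transform at [j * a]. All integrands stay in [[0, 1]], which makes the
    subtraction legitimate. *)
Let laplace_poly (a : R) (m j : nat) : (0 < a)%R ->
  \int[P]_w (expR (- a * X w) ^+ j * (1 - expR (- a * X w)) ^+ m)%:E =
  \int[P']_w (expR (- a * X' w) ^+ j * (1 - expR (- a * X' w)) ^+ m)%:E.
Proof.
move=> a0; elim: m j => [|m IH] j.
  case: j => [|j].
    under eq_integral do rewrite !expr0 mul1r.
    under [RHS]eq_integral do rewrite !expr0 mul1r.
    rewrite (integral_cst P measurableT 1) (integral_cst P' measurableT 1).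
    by rewrite !mul1e; apply: (etrans (probability_setT P)); apply/esym/probability_setT.
  under eq_integral do rewrite expr0 mulr1 -expRM_natl mulrA mulrN.
  under [RHS]eq_integral do rewrite expr0 mulr1 -expRM_natl mulrA mulrN.
  by apply: laplace; rewrite mulr_gt0.
have split0 d0 (T0 : measurableType d0) (P0 : probability T0 R) (Z : T0 -> R) :
    measurable_fun setT Z -> (forall w, 0 <= Z w)%R ->
  \int[P0]_w (expR (- a * Z w) ^+ j * (1 - expR (- a * Z w)) ^+ m.+1)%:E =
  \int[P0]_w (expR (- a * Z w) ^+ j * (1 - expR (- a * Z w)) ^+ m)%:E -
  \int[P0]_w (expR (- a * Z w) ^+ j.+1 * (1 - expR (- a * Z w)) ^+ m)%:E.
  move=> mZ Z0.
  have e01 w : (0 <= expR (- a * Z w) <= 1)%R.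
    by rewrite expR_ge0 -[leRHS]expR0 ler_expR mulNr oppr_le0 mulr_ge0// ltW.
  have me : measurable_fun setT (fun w => expR (- a * Z w)).
    by apply: measurableT_comp => //; exact: measurable_funM.
  have int i : P0.-integrable setT
      (EFin \o (fun w => expR (- a * Z w) ^+ i * (1 - expR (- a * Z w)) ^+ m)%R).
    apply: integrable01.
      apply: measurable_funM; first exact: measurable_funX.
      by apply: measurable_funX; exact: measurable_funB.
    move=> w; have /andP[? ?] := e01 w.
    rewrite mulr_ge0 ?exprn_ge0 ?subr_ge0//= mulr_ile1 ?exprn_ge0 ?subr_ge0//.
      exact: exprn_ile1.
    by rewrite exprn_ile1 ?subr_ge0// lerBlDr lerDl.
  rewrite -integralB_EFin//; apply: eq_integral => w _.
  by rewrite -EFinB; congr (_%:E); rewrite !exprS; ring.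
by rewrite !split0// !IH.
Qed.

Lemma laplace_tail (x : R) : (0 < x)%R ->
  P [set w | (x < X w)%R] = P' [set w | (x < X' w)%R].
Proof.
(* With this [s], [expR (- s * X w) < 1/2] holds exactly when [x < X w], so that the polynomials of
   [cvg_threshold] converge to the indicator of the tail. *)
move=> x0; pose s : R := (ln 2 / x)%R.
have ln2 : (0 < ln (2 : R))%R by rewrite ln_gt0 ?ltr1n.
have s0 : (0 < s)%R by rewrite divr_gt0.
pose c (z : R) n : R := ((1 - expR (- s * z) ^+ n.+1) ^+ (n.+1 * 2 ^ n.+1))%R.
have cvgc d0 (T0 : measurableType d0) (P0 : probability T0 R) (Z : T0 -> R) :
    measurable_fun setT Z -> (forall w, 0 <= Z w)%R ->
    (\int[P0]_w (c (Z w) n)%:E) @[n --> \oo] --> P0 [set w | (x < Z w)%R].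
  move=> mZ Z0; rewrite (_ : P0 _ = \int[P0]_w (\1_[set w | (x < Z w)%R] w)%:E); last first.
    rewrite integral_indic// ?setIT//.
    rewrite -[X in measurable X]setTI (_ : [set w | _] = Z @^-1` `]x, +oo[); last first.
      by apply/seteqP; split => w /=; rewrite in_itv/= andbT.
    exact: mZ.
  have e01 w : (0 < expR (- s * Z w) <= 1)%R.
    by rewrite expR_gt0 -[leRHS]expR0 ler_expR mulNr oppr_le0 mulr_ge0// ltW.
  have mc n : measurable_fun setT (fun w => c (Z w) n).
    apply: measurable_funX; apply: measurable_funB => //; apply: measurable_funX.
    by apply: measurableT_comp => //; exact: measurable_funM.
  apply: (@dominated_cvg _ _ _ P0 setT measurableT _ _ (cst 1)) => //.
  - by move=> n; apply/measurable_EFinP.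
  - move=> w _; apply/cvg_EFin; first by near=> n.
    rewrite /= (_ : \1_ _ w = ((expR (- s * Z w) < 2^-1)%R)%:R :> R).
      exact: cvg_threshold.
    rewrite indicE; congr (_%:R).
    rewrite -[(2^-1)%R]lnK ?posrE ?invr_gt0// ltr_expR lnV ?posrE// mulNr ltrN2.
    rewrite /s mulrAC ltr_pdivlMr// ltr_pM2l//.
    congr nat_of_bool; apply/idP/idP => [/set_mem|] // ?; exact/mem_set.
  - exact: finite_measure_integrable_cst.
  - move=> n w _; rewrite /= lee_fin; have /andP[/ltW e0 e1] := e01 w.
    have c0 : (0 <= 1 - expR (- s * Z w) ^+ n.+1)%R by rewrite subr_ge0 exprn_ile1.
    by rewrite ger0_norm ?exprn_ge0// exprn_ile1// lerBlDr lerDl exprn_ge0.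
have := cvgc _ _ P X mX X_ge0.
rewrite (_ : (fun n => _) = (fun n => \int[P']_w (c (X' w) n)%:E)).
  by move=> H; apply: (cvg_unique _ H) => //; exact: (cvgc _ _ P' X' mX' X'_ge0).
apply/funext => n.
have H := @laplace_poly (n.+1%:R * s) (n.+1 * 2 ^ n.+1) 0 (mulr_gt0 (ltr0Sn _ _) s0).
rewrite /c.
under eq_integral do rewrite -expRM_natl mulrA mulrN -[X in X%:E]mul1r.
under [RHS]eq_integral do rewrite -expRM_natl mulrA mulrN -[X in X%:E]mul1r.
exact: H.
Unshelve. all: by end_near. Qed.

End moments.
End laplace_uniqueness.

(** * Increments of Levy processes *)

Section levy_increments.
Local Open Scope ereal_scope.
Context {R : realType} d (T : measurableType d) (P : probability T R).

Lemma ae_eq_measure (A B : set T) : measurable A -> measurable B ->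
  {ae P, forall w, A w <-> B w} -> P A = P B.
Proof.
move=> mA mB AB; rewrite -[A]setIT -[B]setIT -!integral_indic//.
apply: ge0_ae_eq_integral => //; try exact/measurable_EFinP.
apply: filterS AB => w AB _; congr (_%:E); rewrite !indicE; congr (_%:R).
by congr nat_of_bool; apply/idP/idP => /set_mem /AB ?; exact/mem_set.
Qed.

Lemma integral_law_eq d' (T' : measurableType d') (P' : probability T' R)
    (X : T -> R) (X' : T' -> R) (h : R -> \bar R) :
  measurable_fun setT X -> measurable_fun setT X' ->
  (forall A, measurable A -> P (X @^-1` A) = P' (X' @^-1` A)) ->
  measurable_fun setT h -> (forall x, 0 <= h x) ->
  \int[P]_w h (X w) = \int[P']_w h (X' w).
Proof.
move=> mX mX' XX' mh h0.
apply: (@integral_pair_eq _ _ _ _ _ _ _ P _ _ P' X X X' X' (fun z => h z.1) mX mX mX' mX').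
- by move=> A B mA mB; exact: (XX' (A `&` B) (measurableI A B mA mB)).
- exact: (measurableT_comp mh (@measurable_fst _ _ _ _)).
- by move=> z; exact: h0.
Qed.

Variable X : R -> {RV P >-> R}.
Hypothesis levyX : levy_process X.

Let mX t A : measurable A -> measurable (X t @^-1` A).
Proof. by move=> mA; rewrite -[X in measurable X]setTI; exact: measurable_funPT. Qed.

Let mXB s t A : measurable A -> measurable ((X t \- X s)%R @^-1` A).
Proof.
move=> mA; rewrite -[X in measurable X]setTI.
by apply: measurable_funB => //; exact: measurable_funPT.
Qed.

Lemma levy_increment_law (s r : R) (B : set R) :
  (0 <= s)%R -> (0 <= r)%R -> measurable B ->
  P ((X (s + r)%R \- X s)%R @^-1` B) = P (X r @^-1` B).
Proof.
move=> s0 r0 mB; rewrite (levy_stationary levyX)//.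
apply: ae_eq_measure; [exact: mXB|exact: mX|].
by apply: filterS (levy_start0 levyX) => w /= ->; rewrite subr0.
Qed.

Lemma levy_increment_indep (s r : R) (A B : set R) :
  (0 <= s)%R -> (0 <= r)%R -> measurable A -> measurable B ->
  P (X s @^-1` A `&` (X (s + r)%R \- X s)%R @^-1` B) =
  P (X s @^-1` A) * P (X r @^-1` B).
Proof.
move=> s0 r0 mA mB.
have start0 := levy_start0 levyX.
have -> : P (X s @^-1` A `&` (X (s + r)%R \- X s)%R @^-1` B) =
    P ((X s \- X 0)%R @^-1` A `&` (X (s + r)%R \- X s)%R @^-1` B).
  apply: ae_eq_measure.
  - by apply: measurableI; [exact: mX|exact: mXB].
  - by apply: measurableI; exact: mXB.
  - by apply: filterS start0 => w /= ->; rewrite subr0.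
rewrite (@independent_increments2 _ _ _ _ (fun t => X t))//; last 2 first.
- exact: (levy_independent levyX).
- by rewrite lerDl.
rewrite levy_increment_law//; congr (_ * _).
apply: ae_eq_measure; [exact: mXB|exact: mX|].
by apply: filterS start0 => w /= ->; rewrite subr0.
Qed.

Lemma levy_increment_integral (s r : R) (h : R -> \bar R) :
  (0 <= s)%R -> (0 <= r)%R ->
  measurable_fun setT h -> (forall x, 0 <= h x) ->
  \int[P]_w h (X (s + r) w - X s w)%R = \int[P]_w h (X r w).
Proof.
move=> s0 r0 mh h0.
apply: (@integral_law_eq _ _ P (X (s + r) \- X s)%R (X r) h) => //.
by move=> A mA; exact: levy_increment_law.
Qed.

End levy_increments.

(** * Inverse stable subordinators *)

Section counting_series.
Local Open Scope ereal_scope.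
Context {R : realType}.

Lemma nneseries_ltn (N : nat) : \sum_(n <oo) ((n < N)%N%:R : R)%:E = N%:R%:E.
Proof.
elim: N => [|N IH]; first by rewrite eseries0.
by rewrite nneseriesS// IH -EFinD -[in RHS]natr1 addrC.
Qed.

(** Row [i < m] holds the [n - i - 1] indices strictly between [i] and [n]; the hypothesis [m <= n]
    keeps this truncated subtraction exact. *)
Lemma nneseries_triangle (m n : nat) : (m <= n)%N ->
  \sum_(i <oo) \sum_(j <oo) ((i < m)%N%:R * (i + j.+1 < n)%N%:R : R)%:E =
  (m%:R * n%:R - m%:R * m.+1%:R / 2)%:E.
Proof.
have inner (i p q : nat) : \sum_(j <oo) ((i < p)%N%:R * (i + j.+1 < q)%N%:R : R)%:E =
    ((i < p)%N%:R * (q - i.+1)%N%:R)%:E.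
  rewrite EFinM -(nneseries_ltn (q - i.+1)) -nneseriesZl//.
  by apply: eq_eseriesr => j _; rewrite -EFinM addnS -addSn ltn_subRL.
have ge0 (i p q : nat) : 0 <= (((i < p)%N%:R : R) * (q - i.+1)%N%:R)%:E.
  by rewrite lee_fin mulr_ge0.
under eq_eseriesr do rewrite inner.
elim: m n => [|m IH] [|n]//=; rewrite ?ltnS => mn.
- by rewrite eseries0 ?mul0r ?subr0// => i _ _; rewrite mul0r.
- by rewrite eseries0 ?mul0r ?subr0// => i _ _; rewrite mul0r.
rewrite nneseriesS//; under eq_eseriesr do rewrite ltnS subSS.
rewrite IH// mul1r subn1 -EFinD/= -(natr1 n) -(natr1 m.+1) -(natr1 m); congr (_%:E).
by lra.
Qed.

End counting_series.

(** * Counting grid times before a passage time *)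

Section passage_counts.
Local Open Scope ereal_scope.
Context {R : realType} (T : Type) (D : R -> T -> R).
Hypothesis D_nd : forall s t w, (0 <= s)%R -> (s <= t)%R -> (D s w <= D t w)%R.
Variable h : R.
Hypothesis h_gt0 : (0 < h)%R.

(* [below u n] concerns the time [(n + 1) h]: time [0] is not counted. *)
Definition below (u : R) (n : nat) : set T := [set w | (D (n.+1%:R * h) w <= u)%R].

Definition passage_count u w : \bar R := \sum_(n <oo) (\1_(below u n) w)%:E.

(* Counts the pairs of grid times [s < t] with [D s <= u] and [D t <= v]. *)
Definition passage_pairs u v w : \bar R :=
  \sum_(m <oo) \sum_(n <oo) (\1_(below u m `&` below v (m + n.+1)) w)%:E.

Let Y := inverse_process D.

(** Monotone paths make the grid times with [D <= u] an initial segment. [N] is its length, so that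
    the level [u] is crossed between [N h] and [(N + 1) h]. *)
Lemma passage_countP u w : (exists n : nat, (u < D n%:R w)%R) ->
  exists N : nat, [/\ (N%:R * h <= Y u w)%R, (Y u w <= N.+1%:R * h)%R &
    forall n, \1_(below u n) w = ((n < N)%N)%:R :> R].
Proof.
move=> [n0 Dn0].
have exN : exists n, (u < D (n.+1%:R * h) w)%R.
  exists (Num.truncn (n0%:R / h)); apply: (lt_le_trans Dn0); apply: D_nd => //.
  by rewrite -ler_pdivrMr// ltW// truncnS_gt.
pose N := ex_minn exN.
have [uN Nmin] : (u < D (N.+1%:R * h) w)%R /\
    forall n, (u < D (n.+1%:R * h) w)%R -> (N <= n)%N.
  by rewrite /N; case: ex_minnP.
have belowE n : (D (n.+1%:R * h) w <= u)%R = (n < N)%N.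
  rewrite leNgt; have [nN|Nn] := ltnP n N.
    by apply/negP => /Nmin; rewrite leqNgt nN.
  apply/negbF; apply: (lt_le_trans uN); apply: D_nd.
    by rewrite mulr_ge0// ltW.
  by rewrite ler_pM2r// ler_nat.
exists N; split.
- apply: lb_le_inf.
    by exists (N.+1%:R * h)%R; split=> //; rewrite mulr_ge0// ltW.
  move=> x [x0 ux]; rewrite leNgt; apply/negP => xN.
  (* The time [N h] has index [N - 1] and is a counted grid time only for [N > 0]; for [N = 0] the
     bound is the sign of [x]. *)
  case: N belowE xN {uN Nmin} => [|N'] belowE xN.
    by move: xN; rewrite mul0r ltNge x0.
  have := D_nd w x0 (ltW xN); rewrite leNgt => /negP; apply.
  by apply: le_lt_trans ux; rewrite belowE.
- apply: ge_inf; last by split=> //; rewrite mulr_ge0// ltW.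
  by exists 0%R => x [].
- move=> n; rewrite indicE -belowE; congr (_%:R); congr nat_of_bool.
  by apply/idP/idP => [/set_mem//|?]; exact/mem_set.
Qed.

Lemma passage_count_infty u w : ~ (exists n : nat, (u < D n%:R w)%R) ->
  passage_count u w = +oo /\ Y u w = 0%R.
Proof.
move=> nD.
have Dle x : (0 <= x)%R -> (D x w <= u)%R.
  move=> x0; rewrite leNgt; apply/negP => ux; apply: nD.
  exists (Num.truncn x).+1; apply: (lt_le_trans ux); apply: D_nd => //.
  by rewrite ltW// truncnS_gt.
split; last first.
  rewrite /Y /inverse_process (_ : [set _ | _] = set0) ?inf0//.
  by apply/seteqP; split => // x [x0]; rewrite ltNge Dle.
apply/eqyP => A A0; pose k := (Num.truncn A).+1.
apply: (@le_trans _ _ (\sum_(0 <= i < k) (\1_(below u i) w)%:E)); last first.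
  exact: nneseries_lim_ge.
rewrite (eq_bigr (fun=> 1)).
  by rewrite sumEFin lee_fin sumr_const_nat subn0 ltW// truncnS_gt.
by move=> i _; rewrite indicE mem_set//; apply: Dle; rewrite mulr_ge0// ltW.
Qed.

Lemma passage_count_nat u w (N : nat) :
  (forall n, \1_(below u n) w = ((n < N)%N)%:R :> R) ->
  passage_count u w = N%:R%:E.
Proof.
by move=> NE; rewrite -nneseries_ltn; apply: eq_eseriesr => n _; rewrite NE.
Qed.

Lemma inverse_process_approx u w :
  (`|Y u w - h * fine (passage_count u w)| <= h)%R.
Proof.
have [[N [NY YN NE]]|[-> ->]] :
    (exists N : nat, [/\ (N%:R * h <= Y u w)%R, (Y u w <= N.+1%:R * h)%R &
      forall n, \1_(below u n) w = ((n < N)%N)%:R :> R]) \/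
    (passage_count u w = +oo /\ Y u w = 0%R).
- have [uD|uD] := pselect (exists n : nat, (u < D n%:R w)%R).
    by left; exact: passage_countP.
  by right; exact: passage_count_infty.
- rewrite (passage_count_nat NE) /= mulrC ger0_norm ?subr_ge0//.
  by move: YN; rewrite -natr1; lra.
- by rewrite mulr0 subrr normr0 ltW.
Qed.

Lemma inverse_process_bounds u w : (exists n : nat, (u < D n%:R w)%R) ->
  h%:E * passage_count u w <= (Y u w)%:E <= h%:E * passage_count u w + h%:E.
Proof.
move=> /passage_countP[N [NY YN NE]]; rewrite (passage_count_nat NE).
rewrite -EFinM -EFinD !lee_fin mulrC NY/=.
by move: YN; rewrite -natr1; lra.
Qed.

(** The product counts the pairs of grid indices [(i, j)] with [D <= u] at [i] and [D <= v] at [j].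
    They split into [i = j], [j < i] and [i < j]; as [u <= v] and paths are monotone, the first two
    cases only involve the level [u]. *)
Lemma passage_countM u v w : (u <= v)%R -> (exists n : nat, (v < D n%:R w)%R) ->
  passage_count u w * passage_count v w =
  passage_count u w + passage_pairs u u w + passage_pairs u v w.
Proof.
move=> uv vD; have uD : exists n : nat, (u < D n%:R w)%R.
  by case: vD => n vDn; exists n; exact: le_lt_trans vDn.
have [m [_ _ mE]] := passage_countP uD; have [n [_ _ nE]] := passage_countP vD.
rewrite (passage_count_nat mE) (passage_count_nat nE).
have mn : (m <= n)%N.
  case: m mE => // m mE; have : \1_(below u m) w = 1%R :> R by rewrite mE ltnSn.
  rewrite indicE; case: (boolP (_ \in _)) => [/set_mem /= um _|_ /eqP]; last first.
    by rewrite eq_sym oner_eq0.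
  have := nE m; rewrite indicE mem_set/=; last exact: le_trans uv.
  by case: ltnP => // _ /eqP; rewrite oner_eq0.
have pairsE (u' : R) (p : nat) : (forall i, \1_(below u' i) w = ((i < p)%N)%:R :> R) ->
    (m <= p)%N -> passage_pairs u u' w = (m%:R * p%:R - m%:R * m.+1%:R / 2)%:E.
  move=> pE mp; rewrite -nneseries_triangle//.
  apply: eq_eseriesr => i _; apply: eq_eseriesr => j _.
  by rewrite indicI/= mE pE.
rewrite (pairsE _ _ mE)// (pairsE _ _ nE)// -(natr1 m).
by rewrite -EFinM -!EFinD; congr (_%:E); lra.
Qed.

Lemma inverse_processM_bounds u v w : (u <= v)%R -> (exists n : nat, (v < D n%:R w)%R) ->
  let pairs := passage_count u w + passage_pairs u u w + passage_pairs u v w in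
  (h ^+ 2)%:E * pairs <= (Y u w * Y v w)%:E <=
  (h ^+ 2)%:E * (pairs + (passage_count u w + passage_count v w + 1%:E)).
Proof.
move=> uv vD /=; have uD : exists n : nat, (u < D n%:R w)%R.
  by case: vD => n vDn; exists n; exact: le_lt_trans vDn.
rewrite -passage_countM//.
have [m [mY Ym mE]] := passage_countP uD; have [n [nY Yn nE]] := passage_countP vD.
rewrite (passage_count_nat mE) (passage_count_nat nE).
rewrite -!EFinM !lee_fin.
have h0 := ltW h_gt0.
have mh0 : (0 <= m%:R * h)%R by rewrite mulr_ge0.
have nh0 : (0 <= n%:R * h)%R by rewrite mulr_ge0.
apply/andP; split.
  rewrite (_ : h ^+ 2 * _ = (m%:R * h) * (n%:R * h))%R; last by ring.
  exact: ler_pM.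
apply: (@le_trans _ _ ((m.+1%:R * h) * (n.+1%:R * h))%R).
  by apply: ler_pM => //; [exact: le_trans mY|exact: le_trans nY].
by rewrite -(natr1 m) -(natr1 n); lra.
Qed.

End passage_counts.

Lemma measurable_rv_le {R : realType} d (T : measurableType d)
    (P : probability T R) (X : {RV P >-> R}) (u : R) :
  measurable [set w | X w <= u].
Proof.
rewrite -[X in measurable X]setTI (_ : [set w | _] = X @^-1` `]-oo, u]).
  exact: measurable_funPT.
by apply/seteqP; split => w /=; rewrite in_itv.
Qed.

(** * Mean passage counts and the renewal property *)

Section passage_expectations.
Local Open Scope ereal_scope.
Context {R : realType} d (T : measurableType d) (P : probability T R).
Variables (alpha : R) (D : R -> {RV P >-> R}).
Hypothesis stableD : stable_subordinator alpha D.

Let levyD : levy_process D := subordinator_levy stableD.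
Let D_ge0 t w : (0 <= t)%R -> (0 <= D t w)%R := subordinator_ge0 stableD w.
Let D_nd s t w : (0 <= s)%R -> (s <= t)%R -> (D s w <= D t w)%R :=
  subordinator_nondecreasing stableD w.

Let Y := inverse_process (fun t => D t).
Let K h := @passage_count R T (fun t => D t) h.
Let W h := @passage_pairs R T (fun t => D t) h.
Let E h := @below R T (fun t => D t) h.

(** Chernoff bound with parameter 1, at which the Laplace exponent is 1 whatever [alpha]. *)
Lemma subordinator_le_bound u t : (0 <= t)%R ->
  P [set w | (D t w <= u)%R] <= (expR (u - t))%:E.
Proof.
move=> t0; have := subordinator_laplace stableD ltr01 t0.
rewrite powR1 mulr1 unlock => lap.
rewrite expRD EFinM -lap -ge0_integralZl//; last first.
  by apply/measurable_EFinP; apply: measurableT_comp => //; exact: measurable_funM.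
rewrite -[X in P X]setIT -integral_indic//; last exact: measurable_rv_le.
apply: ge0_le_integral => //.
- by apply/measurable_EFinP; apply: measurable_indic; exact: measurable_rv_le.
- apply: measurable_funeM; apply/measurable_EFinP.
  by apply: measurableT_comp => //; exact: measurable_funM.
- move=> w _; rewrite -EFinM lee_fin -expRD indicE.
  case: (boolP (_ \in _)) => [/set_mem /= Dw|_]; last exact: expR_ge0.
  by rewrite -[leLHS]expR0 ler_expR; lra.
Qed.

Lemma subordinator_unbounded u : {ae P, forall w, exists n : nat, (u < D n%:R w)%R}.
Proof.
pose B := \bigcap_n [set w | (D n%:R w <= u)%R].
have mBn n : measurable [set w | (D n%:R w <= u)%R] by exact: measurable_rv_le.
have mB : measurable B by exact: bigcap_measurable.
exists B; split => //.
- apply/eqP; rewrite eq_le measure_ge0 andbT; apply/lee_addgt0Pr => e e0.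
  rewrite add0e; pose n := (Num.truncn (u - ln e)).+1.
  apply: (@le_trans _ _ (expR (u - n%:R))%:E).
    apply: (le_trans _ (subordinator_le_bound _ _)) => //.
    by apply: le_measure; rewrite ?inE// => w; exact.
  rewrite lee_fin -[leRHS]lnK ?posrE// ler_expR.
  by have := truncnS_gt (u - ln e); rewrite -/n; lra.
- move=> w /= nD n _ /=; rewrite leNgt; apply/negP => uD.
  by apply: nD; exists n.
Qed.

Let mE h u n : measurable (E h u n). Proof. exact: measurable_rv_le. Qed.

Lemma measurable_passage_count h u : measurable_fun setT (K h u).
Proof.
apply: ge0_emeasurable_sum => // n _; exact/measurable_EFinP.
Qed.

Lemma measurable_passage_pairs h u v : measurable_fun setT (W h u v).
Proof.
apply: ge0_emeasurable_sum => [m x _ _|m _]; first exact: nneseries_ge0.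
apply: ge0_emeasurable_sum => // n _.
by apply/measurable_EFinP; apply: measurable_indic; exact: measurableI.
Qed.

Let K_ge0 h u w : 0 <= K h u w. Proof. exact: nneseries_ge0. Qed.

(* On the null set where the path stays below [u], both [inf set0] and
   [fine +oo] are [0], so the approximation holds at every point. *)
Lemma measurable_inverse_process u : measurable_fun setT (Y u).
Proof.
apply: (@measurable_fun_cvg _ _ _ _
  (fun n w => (n.+1%:R^-1 * fine (K n.+1%:R^-1 u w))%R)).
  move=> n; apply: measurable_funM => //; apply: measurableT_comp => //.
  exact: measurable_passage_count.
move=> w _; apply/cvgrPdist_le => e e0; near=> n.
have n0 : (0 < (n.+1%:R^-1 : R))%R by rewrite invr_gt0.
apply: (le_trans (inverse_process_approx D_nd n0 u w)).
near: n; have /cvgrPdist_le/(_ e e0) := @cvg_harmonic R.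
by apply: filterS => n; rewrite sub0r normrN ger0_norm// invr_ge0.
Unshelve. all: by end_near. Qed.

Lemma inverse_process_ge0 u w : (0 <= Y u w)%R.
Proof.
have [[x Dx]|nD] := pselect ([set x | (0 <= x)%R /\ (u < D x w)%R] !=set0).
  by apply: lb_le_inf; [exists x|move=> y []].
rewrite /Y /inverse_process (_ : [set _ | _] = set0) ?inf0//.
by apply/seteqP; split => // x Dx; apply: nD; exists x.
Qed.

Let p h u n := P (E h u n).
Let k h u := \int[P]_w K h u w.

Lemma passage_count_mean h u : k h u = \sum_(n <oo) p h u n.
Proof.
rewrite /k /K /passage_count integral_nneseries//; last first.
  by move=> n; exact/measurable_EFinP.
by apply: eq_eseriesr => n _; rewrite integral_indic// setIT.
Qed.

Lemma passage_pairs_mean h u v : \int[P]_w W h u v w =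
  \sum_(m <oo) \sum_(n <oo) P (E h u m `&` E h v (m + n.+1)).
Proof.
have mI m n : measurable_fun setT
    (fun w => (\1_(E h u m `&` E h v (m + n.+1)) w)%:E : \bar R).
  by apply/measurable_EFinP; apply: measurable_indic; exact: measurableI.
rewrite /W /passage_pairs integral_nneseries//; last 2 first.
- by move=> m; apply: ge0_emeasurable_sum => // n _; exact: mI.
- by move=> m w _; exact: nneseries_ge0.
apply: eq_eseriesr => m _; rewrite integral_nneseries//.
apply: eq_eseriesr => n _; rewrite integral_indic ?setIT//.
exact: measurableI.
Qed.

Section fixed_step.
Variable h : R.
Hypothesis h_gt0 : (0 < h)%R.

(** At the grid times, [subordinator_le_bound] is a geometric sequence of ratio [expR (- h) < 1]. *)
Lemma passage_count_mean_lty u : k h u < +oo.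
Proof.
rewrite passage_count_mean.
pose z : R := expR (- h); have z1 : (z < 1)%R by rewrite expR_lt1 oppr_lt0.
have z0 : (0 < z)%R := expR_gt0 _.
apply: (@le_lt_trans _ _ (expR u / (1 - z))%:E); last exact: ltry.
apply: lime_le; first by apply: is_cvg_nneseries => n _ _; exact: measure_ge0.
apply: nearW => n.
apply: (@le_trans _ _ (\sum_(0 <= i < n) (geometric (expR u) z i)%:E)).
  apply: lee_sum => i _; apply: (le_trans (subordinator_le_bound u _)).
    by rewrite mulr_ge0// ltW.
  rewrite lee_fin /= /z -expRM_natl -expRD ler_expR lerD2l mulrN lerN2.
  by rewrite ler_pM2r// ler_nat.
rewrite sumEFin lee_fin.
have /= := @geometric_seriesE R (expR u) z (negbT (lt_eqF z1)).
move/(congr1 (fun f => f n)); rewrite /series/= => ->.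
rewrite ler_pM2r ?invr_gt0 ?subr_gt0// -[leRHS]mulr1 ler_pM2l ?expR_gt0//.
by rewrite lerBlDr lerDl exprn_ge0// ltW.
Qed.

Lemma passage_count_mean_fin u : k h u \is a fin_num.
Proof.
by rewrite ge0_fin_numE ?passage_count_mean_lty//; apply: integral_ge0.
Qed.

Let sum_indep u v : \sum_(m <oo) \sum_(n <oo) (p h u m * p h v n) = k h u * k h v.
Proof.
have pE w n : p h w n = (fine (p h w n))%:E by rewrite fineK// fin_num_measure.
rewrite -(fineK (passage_count_mean_fin v)) [X in X * _]passage_count_mean.
rewrite muleC -nneseriesZl//; apply: eq_eseriesr => m _.
rewrite fineK ?passage_count_mean_fin// passage_count_mean muleC.
by rewrite [in RHS]pE -nneseriesZl//; apply: eq_eseriesr => n _; rewrite -pE.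
Qed.

Let indep_event u v m n :
  P (E h u m `&` [set w | (D (m.+1%:R * h + n.+1%:R * h) w - D (m.+1%:R * h) w <= v)%R]) =
  p h u m * p h v n.
Proof.
have hn i : (0 <= i.+1%:R * h)%R by rewrite mulr_ge0// ltW.
have := levy_increment_indep levyD (hn m) (hn n)
  (measurable_itv `]-oo, u]) (measurable_itv `]-oo, v]).
rewrite (_ : _ @^-1` _ `&` _ = E h u m `&`
    [set w | (D (m.+1%:R * h + n.+1%:R * h) w - D (m.+1%:R * h) w <= v)%R]).
  move=> ->; rewrite /p; congr (P _ * P _);
    by apply/seteqP; split => w /=; rewrite in_itv.
by apply/seteqP; split => w /=; rewrite !in_itv.
Qed.

(** The index [m + n.+1] in [passage_pairs] stands for a gap of [n.+1] grid steps, so that the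
    increment over this gap has the law of [D] at the grid time of index [n]. *)
Let stepD m n : (m.+1%:R * h + n.+1%:R * h = (m + n.+1).+1%:R * h)%R.
Proof. by rewrite -mulrDl -natrD addSn. Qed.

(* For [s < t], the event [D s <= u, D t <= v] is contained in
   [D s <= u, D t - D s <= v] and contains [D s <= u, D t - D s <= v - u]. *)
Lemma passage_pairs_mean_le u v : \int[P]_w W h u v w <= k h u * k h v.
Proof.
rewrite passage_pairs_mean -sum_indep.
apply: lee_nneseries => [m _ _|m _]; first exact: nneseries_ge0.
apply: lee_nneseries => [n _ _|n _]; first exact: measure_ge0.
rewrite -indep_event; apply: le_measure; rewrite ?inE.
- exact: measurableI.
- apply: measurableI => //.
  rewrite -[X in measurable X]setTI (_ : [set w | _] =
      (D (m.+1%:R * h + n.+1%:R * h) \- D (m.+1%:R * h))%R @^-1` `]-oo, v]).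
    by apply: measurable_funB => //; exact: measurable_funPT.
  by apply/seteqP; split => w /=; rewrite in_itv.
- move=> w [wu wv]; split=> //=; rewrite stepD.
  by apply: le_trans wv; rewrite gerBl D_ge0// mulr_ge0// ltW.
Qed.

Lemma passage_pairs_mean_ge u v : k h u * k h (v - u) <= \int[P]_w W h u v w.
Proof.
rewrite passage_pairs_mean -sum_indep.
apply: lee_nneseries => [m _ _|m _]; first by apply: nneseries_ge0 => n _ _; exact: mule_ge0.
apply: lee_nneseries => [n _ _|n _]; first exact: mule_ge0.
rewrite -indep_event; apply: le_measure; rewrite ?inE.
- apply: measurableI => //.
  rewrite -[X in measurable X]setTI (_ : [set w | _] =
      (D (m.+1%:R * h + n.+1%:R * h) \- D (m.+1%:R * h))%R @^-1` `]-oo, (v - u)%R]).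
    by apply: measurable_funB => //; exact: measurable_funPT.
  by apply/seteqP; split => w /=; rewrite in_itv.
- exact: measurableI.
- move=> w [/= wu wv]; split=> //=; rewrite /E /below/= -stepD.
  by move: wu wv; rewrite /E /below /=; lra.
Qed.

End fixed_step.
End passage_expectations.

(** The letters [k], [q], [a], [b] stand for mean counts, mean counts of pairs, means of [Y] and
    mixed moments of [Y]. Eliminating [quu] between the two inequalities produces [buu / 2], since
    [quu] occurs twice in the bound on [buu]. The other terms are [h^2] times a mean count, hence of
    order [h]. *)
Lemma discretized_upper_bound {R : realType} (h ku kv quu quv au av buu buv : R) :
  0 < h -> h <= 1 -> 0 <= ku -> 0 <= kv ->
  buv <= h ^+ 2 * (ku + quu + quv + (ku + kv + 1)) ->
  h ^+ 2 * (ku + quu + quu) <= buu -> h * ku <= au -> h * kv <= av ->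
  quv <= ku * kv -> buv <= buu / 2 + au * av + h * (2 * au + av + 1).
Proof.
move=> h0 h1 ku0 kv0 Huv Huu Hu Hv Hq; have h20 : 0 < h ^+ 2 by rewrite exprn_gt0.
have Hq2 : h ^+ 2 * quv <= h ^+ 2 * (ku * kv) by rewrite ler_pM2l.
have Ha : (h * ku) * (h * kv) <= au * av by apply: ler_pM => //; rewrite mulr_ge0// ltW.
have Hk : h * (2 * ku + kv + 1) <= 2 * au + av + 1 by lra.
have {}Hk : h * (h * (2 * ku + kv + 1)) <= h * (2 * au + av + 1) by rewrite ler_pM2l.
have k0 : 0 <= h ^+ 2 * ku by rewrite mulr_ge0// ltW.
by lra.
Qed.

(** The same elimination of [quu], with the inequalities reversed. Here [kv] and [av] belong to the
    level [v - u], at which the renewal property bounds [quv] from below. *)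
Lemma discretized_lower_bound {R : realType} (h ku kv quu quv au av buu buv : R) :
  0 < h -> h <= 1 -> 0 <= ku -> 0 <= kv -> 0 <= au -> 0 <= av ->
  h ^+ 2 * (ku + quu + quv) <= buv ->
  buu <= h ^+ 2 * (ku + quu + quu + (ku + ku + 1)) ->
  h * ku <= au -> au <= h * ku + h -> h * kv <= av -> av <= h * kv + h ->
  ku * kv <= quv -> buu / 2 + au * av <= buv + h * (3 * au + av + 2).
Proof.
move=> h0 h1 ku0 kv0 au0 av0 Huv Huu Hu Hu' Hv Hv' Hq.
have h20 : 0 < h ^+ 2 by rewrite exprn_gt0.
have Hq2 : h ^+ 2 * (ku * kv) <= h ^+ 2 * quv by rewrite ler_pM2l.
have Ha : au * av <= (h * ku + h) * (h * kv + h) by exact: ler_pM.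
have Hk : h * (3 * ku + kv + 2) <= 3 * au + av + 2 by lra.
have {}Hk : h * (h * (3 * ku + kv + 2)) <= h * (3 * au + av + 2) by rewrite ler_pM2l.
have k0 : 0 <= h ^+ 2 * ku by rewrite mulr_ge0// ltW.
by lra.
Qed.

(** * Moments of the inverse stable subordinator, by letting the mesh tend to 0 *)

Section inverse_stable_moments.
Context {R : realType} d (T : measurableType d) (P : probability T R).
Variables (alpha : R) (D : R -> {RV P >-> R}).
Hypothesis alpha_gt0 : 0 < alpha.
Hypothesis stableD : stable_subordinator alpha D.

Let levyD : levy_process D := subordinator_levy stableD.
Let D_ge0 t w : 0 <= t -> 0 <= D t w := subordinator_ge0 stableD w.
Let D_nd s t w : 0 <= s -> s <= t -> D s w <= D t w :=
  subordinator_nondecreasing stableD w.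

Let Y := inverse_process (fun t => D t).
Let K h := @passage_count R T (fun t => D t) h.
Let W h := @passage_pairs R T (fun t => D t) h.

Let Y_ge0 u w : 0 <= Y u w := inverse_process_ge0 D u w.
Let mY u : measurable_fun setT (Y u) := measurable_inverse_process stableD u.

Let A u := fine (\int[P]_w (Y u w)%:E)%E.
Let B u v := fine (\int[P]_w (Y u w * Y v w)%:E)%E.
Let k h u := fine (\int[P]_w K h u w)%E.
Let q h u v := fine (\int[P]_w W h u v w)%E.

Lemma le_of_small (x y C : R) :
  (forall h, 0 < h -> h <= 1 -> x <= y + h * C) -> x <= y.
Proof.
move=> H; apply/ler_addgt0Pr => e e0; pose c := `|C| + 1.
have c0 : 0 < c by rewrite ltr_wpDl.
pose h := Num.min 1 (e / c).
have h0 : 0 < h by rewrite lt_min ltr01 divr_gt0.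
apply: (le_trans (H h h0 _)); first by rewrite ge_min lexx.
rewrite lerD2l (@le_trans _ _ (h * c))//.
  by rewrite ler_pM2l// (le_trans (ler_norm C))// lerDl.
by rewrite -ler_pdivlMr// ge_min lexx orbT.
Qed.

Section fixed_step.
Variable h : R.
Hypothesis h_gt0 : 0 < h.

Lemma passage_count_meanE u : (\int[P]_w K h u w = (k h u)%:E)%E.
Proof. by rewrite fineK// (passage_count_mean_fin stableD). Qed.

Let q_fin u v : (\int[P]_w W h u v w)%E \is a fin_num.
Proof.
have W0 : (0 <= \int[P]_w W h u v w)%E.
  by apply: integral_ge0 => w _; apply: nneseries_ge0 => m _ _; exact: nneseries_ge0.
rewrite ge0_fin_numE//; apply: (le_lt_trans (passage_pairs_mean_le stableD h_gt0 u v)).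
by rewrite !passage_count_meanE -EFinM ltry.
Qed.

Lemma passage_pairs_meanE u v : (\int[P]_w W h u v w = (q h u v)%:E)%E.
Proof. by rewrite fineK. Qed.

Lemma inverse_process_mean_bounds u : [/\ (\int[P]_w (Y u w)%:E = (A u)%:E)%E,
  h * k h u <= A u & A u <= h * k h u + h].
Proof.
have mK := measurable_passage_count D h u.
have lo : (\int[P]_w (h%:E * K h u w) <= \int[P]_w (Y u w)%:E)%E.
  apply: ae_ge0_le_integral => //.
  - by move=> w _; rewrite mule_ge0 ?lee_fin ?(ltW h_gt0)//; exact: nneseries_ge0.
  - exact: measurable_funeM.
  - by move=> w _; rewrite lee_fin.
  - exact/measurable_EFinP.
  - apply: filterS (subordinator_unbounded stableD u) => w uD _.
    by have /andP[] := inverse_process_bounds D_nd h_gt0 uD.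
have up : (\int[P]_w (Y u w)%:E <= \int[P]_w (h%:E * K h u w + h%:E))%E.
  apply: ae_ge0_le_integral => //.
  - by move=> w _; rewrite lee_fin.
  - exact/measurable_EFinP.
  - move=> w _; rewrite adde_ge0 ?mule_ge0 ?lee_fin ?(ltW h_gt0)//.
    exact: nneseries_ge0.
  - by apply: emeasurable_funD => //; exact: measurable_funeM.
  - apply: filterS (subordinator_unbounded stableD u) => w uD _.
    by have /andP[] := inverse_process_bounds D_nd h_gt0 uD.
have intK : (\int[P]_w (h%:E * K h u w) = (h * k h u)%:E)%E.
  rewrite ge0_integralZl//; first by rewrite passage_count_meanE -EFinM.
  - by move=> w _; exact: nneseries_ge0.
  - by rewrite lee_fin ltW.
have intKh : (\int[P]_w (h%:E * K h u w + h%:E) = (h * k h u + h)%:E)%E.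
  rewrite ge0_integralD//.
  - rewrite intK (integral_cst P measurableT h%:E) [X in (_ * X)%E](_ : _ = 1%E) ?mule1//.
    exact: probability_setT.
  - by move=> w _; rewrite mule_ge0 ?lee_fin ?(ltW h_gt0)//; exact: nneseries_ge0.
  - exact: measurable_funeM.
  - by move=> w _; rewrite lee_fin ltW.
have Yfin : (\int[P]_w (Y u w)%:E < +oo)%E.
  by move: up; rewrite intKh => /le_lt_trans; apply; exact: ltry.
have AE : (\int[P]_w (Y u w)%:E = (A u)%:E)%E.
  by rewrite fineK// ge0_fin_numE//; apply: integral_ge0 => w _; rewrite lee_fin.
by move: lo up; rewrite intK intKh AE !lee_fin => ? ?; split.
Qed.

Lemma inverse_processM_mean_bounds u v : u <= v ->
  [/\ (\int[P]_w (Y u w * Y v w)%:E = (B u v)%:E)%E,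
    h ^+ 2 * (k h u + q h u u + q h u v) <= B u v &
    B u v <= h ^+ 2 * (k h u + q h u u + q h u v + (k h u + k h v + 1))].
Proof.
move=> uv; have h0 := ltW h_gt0.
have mK t := measurable_passage_count D h t.
have mW s t := measurable_passage_pairs D h s t.
have K0 t w : (0 <= K h t w)%E by exact: nneseries_ge0.
have W0 s t w : (0 <= W h s t w)%E.
  by apply: nneseries_ge0 => m _ _; exact: nneseries_ge0.
pose S w := (K h u w + W h u u w + W h u v w)%E.
have S0 w : (0 <= S w)%E by rewrite !adde_ge0.
have mS : measurable_fun setT S.
  by apply: emeasurable_funD => //; exact: emeasurable_funD.
have h20 : (0 <= (h ^+ 2)%:E :> \bar R)%E by rewrite lee_fin sqr_ge0.
have intS : (\int[P]_w S w = (k h u + q h u u + q h u v)%:E)%E.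
  rewrite ge0_integralD//; last 2 first.
  - by move=> w _; rewrite adde_ge0.
  - exact: emeasurable_funD.
  by rewrite ge0_integralD// passage_count_meanE !passage_pairs_meanE -!EFinD.
pose S' w := (K h u w + K h v w + 1%:E)%E.
have S'0 w : (0 <= S' w)%E by rewrite !adde_ge0.
have mS' : measurable_fun setT S'.
  by apply: emeasurable_funD => //; exact: emeasurable_funD.
have intS' : (\int[P]_w S' w = (k h u + k h v + 1)%:E)%E.
  rewrite ge0_integralD//; last 2 first.
  - by move=> w _; rewrite adde_ge0.
  - exact: emeasurable_funD.
  rewrite ge0_integralD// !passage_count_meanE (integral_cst P measurableT 1%:E).
  rewrite [X in (_ * X)%E](_ : _ = 1%E) ?mule1//; exact: probability_setT.
have lo : ((h ^+ 2 * (k h u + q h u u + q h u v))%:E <= \int[P]_w (Y u w * Y v w)%:E)%E.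
  rewrite EFinM -intS -ge0_integralZl//.
  apply: ae_ge0_le_integral => //.
  - by move=> w _; rewrite mule_ge0.
  - exact: measurable_funeM.
  - by move=> w _; rewrite lee_fin mulr_ge0.
  - by apply/measurable_EFinP; exact: measurable_funM.
  - apply: filterS (subordinator_unbounded stableD v) => w vD _.
    by have /andP[] := inverse_processM_bounds D_nd h_gt0 uv vD.
have up : (\int[P]_w (Y u w * Y v w)%:E <=
    (h ^+ 2 * (k h u + q h u u + q h u v + (k h u + k h v + 1)))%:E)%E.
  rewrite EFinM EFinD -intS -intS' -ge0_integralD//.
  rewrite -ge0_integralZl//; last 2 first.
  - exact: emeasurable_funD.
  - by move=> w _; rewrite adde_ge0.
  apply: ae_ge0_le_integral => //.
  - by move=> w _; rewrite lee_fin mulr_ge0.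
  - by apply/measurable_EFinP; exact: measurable_funM.
  - by move=> w _; rewrite mule_ge0// adde_ge0.
  - by apply: measurable_funeM; exact: emeasurable_funD.
  - apply: filterS (subordinator_unbounded stableD v) => w vD _.
    by have /andP[] := inverse_processM_bounds D_nd h_gt0 uv vD.
have Bfin : (\int[P]_w (Y u w * Y v w)%:E < +oo)%E.
  by apply: (le_lt_trans up); exact: ltry.
have BE : (\int[P]_w (Y u w * Y v w)%:E = (B u v)%:E)%E.
  rewrite fineK// ge0_fin_numE//; apply: integral_ge0 => w _.
  by rewrite lee_fin mulr_ge0.
by move: lo up; rewrite BE !lee_fin => ? ?; split.
Qed.

End fixed_step.

(* [D (c^alpha x) / c] and [D x] have the same Laplace transform. *)
Lemma stable_subordinator_scaling (c x u : R) : 0 < c -> 0 <= x -> 0 < u ->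
  P [set w | D (c `^ alpha * x) w <= c * u] = P [set w | D x w <= u].
Proof.
move=> c0 x0 u0; have cx0 : 0 <= c `^ alpha * x by rewrite mulr_ge0// powR_ge0.
have tail : P [set w | u < D (c `^ alpha * x) w / c] = P [set w | u < D x w].
  apply: (@laplace_tail _ _ _ P _ _ P (fun w => D (c `^ alpha * x) w / c) (D x)) => //.
  - exact: measurable_funM.
  - by move=> w; rewrite divr_ge0// ?D_ge0// ltW.
  - by move=> w; exact: D_ge0.
  move=> s s0; have := subordinator_laplace stableD (divr_gt0 s0 c0) cx0.
  have := subordinator_laplace stableD s0 x0; rewrite unlock => -> .
  under [X in X = _ -> _]eq_integral do rewrite -mulNr -mulrA [_^-1 * _]mulrC.
  move=> ->; congr (expR _)%:E.
  rewrite powRM ?invr_ge0 ?(ltW s0) ?(ltW c0)// -powR_inv1 ?(ltW c0)// -powRrM mulN1r powRN.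
  by field; rewrite gt_eqF ?powR_gt0.
have compl (X : T -> R) a : measurable_fun setT X ->
    P [set w | X w <= a] = (1 - P [set w | (a < X w)%R])%E.
  move=> mX; rewrite -probability_setC.
    by congr (P _); apply/seteqP; split => w /=; rewrite leNgt => /negP.
  rewrite -[X in measurable X]setTI (_ : [set w | _] = X @^-1` `]a, +oo[); first exact: mX.
  by apply/seteqP; split => w /=; rewrite in_itv/= andbT.
rewrite (compl (D x))// -tail -compl; last exact: measurable_funM.
by congr (P _); apply/seteqP; split => w /=; rewrite ler_pdivrMr// [u * c]mulrC.
Qed.

Let k_scaling c h u : 0 < c -> 0 < h -> 0 < u ->
  k (c `^ alpha * h) (c * u) = k h u.
Proof.
move=> c0 h0 u0; rewrite /k !passage_count_mean; congr fine.
apply: eq_eseriesr => n _; rewrite /below.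
have nh0 : 0 <= n.+1%:R * h by rewrite mulr_ge0// ltW.
by rewrite -(stable_subordinator_scaling c0 nh0 u0) mulrCA.
Qed.

Let q_scaling c h u : 0 < c -> 0 < h -> 0 < u ->
  q (c `^ alpha * h) (c * u) (c * u) = q h u u.
Proof.
move=> c0 h0 u0; rewrite /q !passage_pairs_mean; congr fine.
(* At equal levels the earlier event contains the later one, so that each pair of events reduces to
   one event and scaling of one-dimensional laws is enough. *)
have nested (h' : R) u' m n : 0 < h' ->
    below (fun t => D t) h' u' m `&` below (fun t => D t) h' u' (m + n.+1) =
    below (fun t => D t) h' u' (m + n.+1).
  move=> h'0; apply/setIidPr => w; apply: le_trans; apply: D_nd.
    by rewrite mulr_ge0// ltW.
  by rewrite ler_pM2r// ler_nat ltnS leq_addr.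
apply: eq_eseriesr => m _; apply: eq_eseriesr => n _.
rewrite !nested ?mulr_gt0 ?powR_gt0// /below.
have nh0 : 0 <= (m + n.+1).+1%:R * h by rewrite mulr_ge0// ltW.
by rewrite -(stable_subordinator_scaling c0 nh0 u0) mulrCA.
Qed.

Let A_ge0 u : 0 <= A u.
Proof. by apply/fine_ge0/integral_ge0 => w _; rewrite lee_fin. Qed.

Let k_ge0 h u : 0 <= k h u.
Proof. by apply/fine_ge0/integral_ge0 => w _; exact: nneseries_ge0. Qed.

(** The mean count at level [c * u] with mesh [c^alpha * h] equals the one at level [u] with mesh
    [h]. In both cases the mean of [Y] differs from mesh times count by at most one mesh, which
    tends to 0 with [h]. *)
Let A_scaling c u : 0 < c -> 0 < u -> A (c * u) = c `^ alpha * A u.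
Proof.
move=> c0 u0; set c' := c `^ alpha; have c'0 : 0 < c' by rewrite powR_gt0.
apply/eqP; rewrite eq_le; apply/andP; split; apply: (@le_of_small _ _ c') => h h0 h1.
- have [_ _] := inverse_process_mean_bounds (mulr_gt0 c'0 h0) (c * u).
  rewrite k_scaling// => H; apply: (le_trans H).
  have [_ H' _] := inverse_process_mean_bounds h0 u.
  have : c' * (h * k h u) <= c' * A u by rewrite ler_pM2l.
  by lra.
- have [_ + _] := inverse_process_mean_bounds (mulr_gt0 c'0 h0) (c * u).
  rewrite k_scaling// => H.
  have [_ _ H'] := inverse_process_mean_bounds h0 u.
  have : c' * A u <= c' * (h * k h u + h) by rewrite ler_pM2l.
  by lra.
Qed.

Let B_approx h u : 0 < h -> h <= 1 ->
  h ^+ 2 * (k h u + q h u u + q h u u) <= B u u /\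
  h ^+ 2 * (k h u + q h u u + q h u u + (k h u + k h u + 1)) <=
    h ^+ 2 * (k h u + q h u u + q h u u) + h * (2 * A u + 1).
Proof.
move=> h0 h1; have [_ ? _] := inverse_processM_mean_bounds h0 (lexx u); split => //.
rewrite mulrDr lerD2l expr2 -mulrA ler_pM2l//.
have [_ H _] := inverse_process_mean_bounds h0 u.
by lra.
Qed.

Let B_scaling c u : 0 < c -> 0 < u -> B (c * u) (c * u) = c `^ alpha ^+ 2 * B u u.
Proof.
move=> c0 u0; set c' := c `^ alpha; have c'0 : 0 < c' by rewrite powR_gt0.
have c'20 : 0 < c' ^+ 2 by rewrite exprn_gt0.
apply/eqP; rewrite eq_le; apply/andP; split;
  apply: (@le_of_small _ _ (c' ^+ 2 * (2 * A u + 1))) => h h0 h1.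
- have [_ _] := inverse_processM_mean_bounds (mulr_gt0 c'0 h0) (lexx (c * u)).
  rewrite k_scaling// q_scaling// => H; apply: (le_trans H).
  have [H1 H2] := B_approx u h0 h1.
  have := le_trans H2 (lerD H1 (lexx _)); rewrite -(ler_pM2l c'20).
  by lra.
- have [_ + _] := inverse_processM_mean_bounds (mulr_gt0 c'0 h0) (lexx (c * u)).
  rewrite k_scaling// q_scaling// => H.
  have [_ _ H'] := inverse_processM_mean_bounds h0 (lexx u).
  have [H1 H2] := B_approx u h0 h1.
  have := le_trans H' H2; rewrite -(ler_pM2l c'20).
  by lra.
Qed.

Let B_le u v : u <= v -> B u v <= B u u / 2 + A u * A v.
Proof.
move=> uv; apply: (@le_of_small _ _ (2 * A u + A v + 1)) => h h0 h1.
have [_ _ HB] := inverse_processM_mean_bounds h0 uv.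
have [_ HBu _] := inverse_processM_mean_bounds h0 (lexx u).
have [_ HAu _] := inverse_process_mean_bounds h0 u.
have [_ HAv _] := inverse_process_mean_bounds h0 v.
apply: (discretized_upper_bound h0 h1 _ _ HB HBu HAu HAv); [exact: k_ge0|exact: k_ge0|].
have := passage_pairs_mean_le stableD h0 u v.
by rewrite !passage_count_meanE// passage_pairs_meanE// -EFinM lee_fin.
Qed.

Let B_ge u v : u <= v -> B u u / 2 + A u * A (v - u) <= B u v.
Proof.
move=> uv; apply: (@le_of_small _ _ (3 * A u + A (v - u) + 2)) => h h0 h1.
have [_ HB _] := inverse_processM_mean_bounds h0 uv.
have [_ _ HBu] := inverse_processM_mean_bounds h0 (lexx u).
have [_ HAu HAu'] := inverse_process_mean_bounds h0 u.
have [_ HAv HAv'] := inverse_process_mean_bounds h0 (v - u).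
apply: (discretized_lower_bound h0 h1 _ _ (A_ge0 u) (A_ge0 (v - u)) HB HBu HAu HAu'
  HAv HAv'); [exact: k_ge0|exact: k_ge0|].
have := passage_pairs_mean_ge stableD h0 u v.
by rewrite !passage_count_meanE// passage_pairs_meanE// -EFinM lee_fin.
Qed.

(** Scaling only relates positive levels. Level 0 is reached by comparing its count with that of the
    level [h^(1/alpha)], at which the mean of [Y] is [h * A 1]; this gives
    [A 0 <= h * (A 1 + 1)]. *)
Let A0 : A 0 = 0.
Proof.
apply/eqP; rewrite eq_le A_ge0 andbT; apply: (@le_of_small _ _ (A 1 + 1)) => h h0 h1.
pose u := h `^ alpha^-1; have u0 : 0 < u by rewrite powR_gt0.
have Au : A u = h * A 1.
  by rewrite -[in LHS](mulr1 u) A_scaling// /u -powRrM mulVf ?gt_eqF// powRr1// ltW.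
have [_ _ H0] := inverse_process_mean_bounds h0 0.
have [_ Hu _] := inverse_process_mean_bounds h0 u.
have : h * k h 0 <= h * k h u.
  rewrite ler_pM2l// -lee_fin -!passage_count_meanE// !passage_count_mean.
  apply: lee_nneseries => [n _ _|n _]; first exact: measure_ge0.
  apply: le_measure; rewrite ?inE; try exact: measurable_rv_le.
  by move=> w /= /le_trans; apply; exact: ltW.
by rewrite Au in Hu; lra.
Qed.

Let B_ge0 u v : 0 <= B u v.
Proof. by apply/fine_ge0/integral_ge0 => w _; rewrite lee_fin mulr_ge0. Qed.

Let AE u : 0 <= u -> A u = A 1 * u `^ alpha.
Proof.
rewrite le_eqVlt => /predU1P[<-|u0]; first by rewrite A0 powR0 ?mulr0// gt_eqF.
by rewrite -[in LHS](mulr1 u) A_scaling// mulrC.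
Qed.

Let BE u : 0 <= u -> B u u = B 1 1 * (u `^ alpha) ^+ 2.
Proof.
rewrite le_eqVlt => /predU1P[<-|u0]; last first.
  by rewrite -[in LHS](mulr1 u) B_scaling// mulrC.
rewrite powR0 ?gt_eqF// expr0n mulr0; apply/eqP; rewrite eq_le B_ge0 andbT.
(* At [u = v = 0] the upper bound reads [B 0 0 <= B 0 0 / 2]. *)
by have := B_le (lexx 0); rewrite A0; lra.
Qed.

Let laplace1 s t : 0 < s -> 0 <= t ->
  (\int[P]_w (expR (- s * D t w))%:E = (expR (- t * s `^ alpha))%:E)%E.
Proof. by move=> s0 t0; have := subordinator_laplace stableD s0 t0; rewrite unlock. Qed.

Let measurable_exp s t : measurable_fun setT (fun w => expR (- s * D t w)).
Proof. by apply: measurableT_comp => //; exact: measurable_funM. Qed.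

(** With mesh 1/2 it suffices that [D] is at most 1 at time 1/2 with positive probability. Otherwise
    the mean of [expR (- D)] at this time would be at most [expR (- 1)], whereas it is
    [expR (- 1/2)]. *)
Let A1_gt0 : 0 < A 1.
Proof.
have half0 : 0 < 2^-1 :> R by [].
have [_ + _] := inverse_process_mean_bounds half0 1; apply: lt_le_trans.
rewrite mulr_gt0// -lte_fin -passage_count_meanE// passage_count_mean.
rewrite nneseriesS//.
apply: (@lt_le_trans _ _ (P (below (fun t => D t) 2^-1 1 0))); last first.
  by rewrite leeDl//; exact: nneseries_ge0.
rewrite /below mul1r; set F := [set w | _]; have mF : measurable F by exact: measurable_rv_le.
have := laplace1 ltr01 (ltW half0); rewrite powR1 mulr1 => lap.
have : (\int[P]_w (expR (- 1 * D 2^-1 w))%:E <= \int[P]_w ((\1_F w)%:E + (expR (- 1))%:E))%E.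
  apply: ge0_le_integral => //.
  - exact/measurable_EFinP.
  - by apply: emeasurable_funD => //; exact/measurable_EFinP.
  - move=> w _; rewrite -EFinD lee_fin indicE.
    case: (boolP (w \in F)) => [_|]; rewrite /= ?mulN1r.
      by rewrite (@le_trans _ _ 1) ?lerDl ?expR_ge0// -expR0 ler_expR oppr_le0 D_ge0.
    rewrite notin_setE /F /= add0r ler_expR lerN2 => /negP.
    by rewrite -ltNge => /ltW.
rewrite lap ge0_integralD//; last exact/measurable_EFinP.
rewrite integral_indic// setIT (integral_cst P measurableT (expR (-1))%:E).
rewrite [X in (_ + _ * X)%E](_ : _ = 1%E) ?mule1; last exact: probability_setT.
rewrite -leeBlDr// => /(lt_le_trans _); apply.
by rewrite -EFinB lte_fin subr_gt0 ltr_expR; lra.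
Qed.

(* If [Y 1] were almost surely a constant [c], then [D x <= 1] almost surely for
   [x < c], whence [x s^alpha <= s] for all [s > 0], which fails as [s] tends
   to [0]. *)
Let B_gt : alpha < 1 -> A 1 ^+ 2 < B 1 1.
Proof.
move=> alpha1; rewrite ltNge; apply/negP => BA; pose c := A 1.
have [EA _ _] := inverse_process_mean_bounds (@ltr01 R) 1.
have [EB _ _] := inverse_processM_mean_bounds (@ltr01 R) (lexx (1 : R)).
have mYc : measurable_fun setT (fun w => ((Y 1 w - c) ^+ 2)%:E : \bar R).
  by apply/measurable_EFinP; apply: measurable_funX; exact: measurable_funB.
have c0 : 0 <= c := A_ge0 1.
(* The expansion of the square is arranged without subtraction, so that additivity of integrals of
   nonnegative functions applies. *)
have EV : (\int[P]_w ((Y 1 w - c) ^+ 2)%:E + (2 * c * c)%:E = (B 1 1 + c ^+ 2)%:E)%E.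
  have -> : (B 1 1 + c ^+ 2)%:E = (\int[P]_w ((Y 1 w * Y 1 w)%:E + (c ^+ 2)%:E))%E.
    rewrite ge0_integralD//.
    - rewrite EB (integral_cst P measurableT (c ^+ 2)%:E).
      rewrite [X in (_ + _ * X)%E](_ : _ = 1%E) ?mule1//; exact: probability_setT.
    - by move=> w _; rewrite lee_fin mulr_ge0.
    - by apply/measurable_EFinP; exact: measurable_funM.
    - by move=> w _; rewrite lee_fin sqr_ge0.
  have -> : (2 * c * c)%:E = (\int[P]_w ((2 * c)%:E * (Y 1 w)%:E))%E.
    rewrite ge0_integralZl//; first by rewrite EA -EFinM.
    - exact/measurable_EFinP.
    - by move=> w _; rewrite lee_fin.
    - by rewrite lee_fin mulr_ge0.
  rewrite -ge0_integralD//.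
  - by apply: eq_integral => w _; rewrite -EFinM -!EFinD; congr (_%:E); ring.
  - by move=> w _; rewrite lee_fin sqr_ge0.
  - by move=> w _; rewrite -EFinM lee_fin !mulr_ge0.
  - by apply: measurable_funeM; exact/measurable_EFinP.
have V0 : (\int[P]_w `|((Y 1 w - c) ^+ 2)%:E| = 0)%E.
  under eq_integral do rewrite gee0_abs ?lee_fin ?sqr_ge0//.
  apply/eqP; rewrite eq_le; apply/andP; split; last first.
    by apply: integral_ge0 => w _; rewrite lee_fin sqr_ge0.
  rewrite -(leeD2rE _ _ (isT : (2 * c * c)%:E \is a fin_num)) EV add0e lee_fin.
  by move: BA; rewrite -/c; lra.
have Yc : {ae P, forall w, Y 1 w = c}.
  have [/(_ V0) + _] := ae_eq_integral_abs P measurableT mYc.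
  apply: filterS => w /(_ I)[] /eqP.
  by rewrite sqrf_eq0 subr_eq0 => /eqP.
pose x := c / 2; have x0 : 0 < x by rewrite divr_gt0.
have Dx : {ae P, forall w, D x w <= 1}.
  apply: filterS2 Yc (subordinator_unbounded stableD 1) => w Yw _.
  rewrite leNgt; apply/negP => D1.
  have : Y 1 w <= x.
    by apply: ge_inf; [by exists 0 => y []|split => //; exact: ltW].
  by rewrite Yw /x; have := A1_gt0; rewrite -/c; lra.
have lap s : 0 < s -> x * s `^ alpha <= s.
  move=> s0; suff : ((expR (- s))%:E <= (expR (- x * s `^ alpha))%:E)%E.
    by rewrite lee_fin ler_expR mulNr lerN2.
  rewrite -(laplace1 s0 (ltW x0)).
  have -> : (expR (- s))%:E = (\int[P]_w (expR (- s))%:E)%E.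
    rewrite (integral_cst P measurableT (expR (- s))%:E).
    by rewrite [X in (_ * X)%E](_ : _ = 1%E) ?mule1//; exact: probability_setT.
  apply: ae_ge0_le_integral => //.
  - exact/measurable_EFinP.
  - apply: filterS Dx => w Dw _.
    by rewrite lee_fin ler_expR mulNr lerN2 -[leRHS]mulr1 ler_pM2l.
(* This [s] satisfies [s = s^alpha * (x / 2)], which contradicts [x * s^alpha <= s]. *)
pose s := (x / 2) `^ (1 - alpha)^-1.
have x20 : 0 < x / 2 by rewrite divr_gt0.
have s0 : 0 < s by rewrite powR_gt0.
have s1 : s `^ (1 - alpha) = x / 2.
  by rewrite /s -powRrM mulVf ?powRr1 ?(ltW x20)// gt_eqF ?subr_gt0.
have sE : s = s `^ alpha * (x / 2).
  rewrite -s1 -powRD; first by rewrite addrC subrK powRr1// ltW.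
  by rewrite addrC subrK oner_eq0.
have := lap s s0; rewrite {2}sE mulrC ler_pM2l ?powR_gt0//.
by lra.
Qed.

Lemma inverse_stable_moments : alpha < 1 -> exists c b : R,
  [/\ 0 < c, c ^+ 2 < b,
    forall u, 0 <= u -> (\int[P]_w (Y u w)%:E = (c * u `^ alpha)%:E)%E,
    forall u, 0 <= u ->
      (\int[P]_w (Y u w * Y u w)%:E = (b * (u `^ alpha) ^+ 2)%:E)%E &
    forall u v, 0 <= u -> u <= v -> exists2 r,
      (\int[P]_w (Y u w * Y v w)%:E = r%:E)%E &
      b / 2 * (u `^ alpha) ^+ 2 + c ^+ 2 * (u `^ alpha * (v - u) `^ alpha) <= r
        <= b / 2 * (u `^ alpha) ^+ 2 + c ^+ 2 * (u `^ alpha * v `^ alpha)].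
Proof.
move=> alpha1; exists (A 1), (B 1 1); split => //.
- exact: B_gt.
- move=> u u0; rewrite -AE//.
  by have [] := inverse_process_mean_bounds (@ltr01 R) u.
- move=> u u0; rewrite -BE//.
  by have [] := inverse_processM_mean_bounds (@ltr01 R) (lexx u).
- move=> u v u0 uv; exists (B u v).
    by have [] := inverse_processM_mean_bounds (@ltr01 R) uv.
  have vu0 : 0 <= v - u by rewrite subr_ge0.
  have := B_ge uv; have := B_le uv; have v0 := le_trans u0 uv.
  rewrite (AE u0) (AE v0) (AE vu0) (BE u0) => H1 H2.
  by apply/andP; split; lra.
Qed.

End inverse_stable_moments.

(** * Fractional counting processes *)

Section time_change_moments.
Context {R : realType} d (T : measurableType d) (P : probability T R).
Variables (X : R -> {RV P >-> R}) (D : R -> T -> R).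
Hypothesis countX : counting_process (fun t => X t).
Hypothesis mD : forall t, 0 <= t -> measurable_fun setT (D t).
Hypothesis D_ge0 : forall t w, 0 <= t -> 0 <= D t w.
Hypothesis indep : independent_processes P (fun t => X t) D.

Let Z := time_change (fun t => X t) D.

Lemma counting_process_ge0 t w : 0 <= t -> 0 <= X t w.
Proof. by move=> /(counting_nat countX w)[n ->]. Qed.

Let mX (t : R) : 0 <= t -> measurable_fun setT (X t). Proof. by []. Qed.

Let right_continuousX (t : R) w : 0 <= t -> X s w @[s --> t^'+] --> X t w.
Proof. by move=> t0; exact: (counting_right_continuous countX). Qed.

Lemma measurable_counting_time_change t : 0 <= t -> measurable_fun setT (Z t).
Proof.
by move=> t0; exact: (measurable_time_change mX right_continuousX).
Qed.

Lemma time_change_mean t : 0 <= t ->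
  (\int[P]_w (Z t w)%:E = \int[P]_w2 \int[P]_w1 (X (D t w2) w1)%:E)%E.
Proof.
move=> t0; pose h (z : R * R) : \bar R := `|z.1|%:E.
have mh : measurable_fun [set: R * R] h.
  by apply/measurable_EFinP; apply: measurableT_comp => //; exact: normr_measurable.
have h0 z : (0 <= h z)%E by rewrite lee_fin.
transitivity (\int[P]_w h (Z t w, Z t w))%E.
  by apply: eq_integral => w _; rewrite /h/= ger0_norm// counting_process_ge0// D_ge0.
rewrite (integral_time_change mX right_continuousX mD D_ge0 indep t0 t0 mh h0).
apply: eq_integral => w2 _; apply: eq_integral => w1 _.
by rewrite /h/= ger0_norm// counting_process_ge0// D_ge0.
Qed.

Lemma time_change_mixed_moment s t : 0 <= s -> 0 <= t ->
  (\int[P]_w (Z s w * Z t w)%:E =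
   \int[P]_w2 \int[P]_w1 (X (D s w2) w1 * X (D t w2) w1)%:E)%E.
Proof.
move=> s0 t0; pose h (z : R * R) : \bar R := `|z.1 * z.2|%:E.
have mh : measurable_fun [set: R * R] h.
  apply/measurable_EFinP; apply: measurableT_comp; first exact: normr_measurable.
  exact: measurable_funM.
have h0 z : (0 <= h z)%E by rewrite lee_fin.
have X0 r w w' : 0 <= r -> 0 <= X (D r w) w'.
  by move=> r0; rewrite counting_process_ge0// D_ge0.
transitivity (\int[P]_w h (Z s w, Z t w))%E.
  by apply: eq_integral => w _; rewrite /h/= ger0_norm// mulr_ge0// X0.
rewrite (integral_time_change mX right_continuousX mD D_ge0 indep s0 t0 mh h0).
apply: eq_integral => w2 _; apply: eq_integral => w1 _.
by rewrite /h/= ger0_norm// mulr_ge0// X0.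
Qed.

Lemma measurable_conditional_mixed_moment s t : 0 <= s -> 0 <= t ->
  measurable_fun setT (fun w2 => \int[P]_w1 (X (D s w2) w1 * X (D t w2) w1)%:E)%E.
Proof.
move=> s0 t0.
pose f (z : T * T) : \bar R := (`|X `|D s z.2| z.1 * X `|D t z.2| z.1|)%:E.
have mXD r : 0 <= r -> measurable_fun setT (fun z : T * T => X `|D r z.2| z.1).
  move=> r0; pose g (z : T * T) : R * T := (D r z.2, z.1).
  apply: (@measurableT_comp _ _ _ _ _ _ (fun z : R * T => X `|z.1| z.2) _ g).
    exact: (measurable_right_continuous mX right_continuousX).
  by apply: measurable_fun_pair => //; apply: measurableT_comp => //; exact: mD.
have mf : measurable_fun [set: T * T] f.
  apply/measurable_EFinP; apply: measurableT_comp; first exact: normr_measurable.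
  by apply: measurable_funM; exact: mXD.
have f0 z : (0 <= f z)%E by rewrite lee_fin.
have := @measurable_fun_fubini_tonelli_G _ _ T T R P f mf f0; rewrite /fubini_G /f /=.
congr (measurable_fun setT); apply/funext => w2; apply: eq_integral => w1 _.
by rewrite ger0_norm ?mulr_ge0 ?counting_process_ge0// !ger0_norm// D_ge0.
Qed.

End time_change_moments.

Section fractional_moments.
Context {R : realType} (k : nat) (lambda : 'I_k -> R) (alpha : R).
Hypothesis lambda_gt0 : forall j, 0 < lambda j.
Hypotheses (alpha_gt0 : 0 < alpha) (alpha_lt1 : alpha < 1).
Context d (T : measurableType d) (P : probability T R) (X : R -> {RV P >-> R}).
Hypothesis fractionalX : generalized_fractional_counting_process alpha lambda X.

Let S1 := jump_moment lambda 1.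
Let S2 := jump_moment lambda 2.

(** The path must exceed [v]: otherwise the infimum at [v] is over the empty set and takes the
    default value 0, which may lie below the one at [u]. *)
Lemma inverse_process_nd (U : Type) (D : R -> U -> R) u v w :
  (exists n : nat, v < D n%:R w) -> u <= v ->
  inverse_process D u w <= inverse_process D v w.
Proof.
move=> [n vD] uv; apply: lb_le_inf; first by exists n%:R.
move=> x [x0 vx]; apply: ge_inf; first by exists 0 => y [].
by split=> //; exact: le_lt_trans vx.
Qed.

Lemma fractional_counting_moments : exists c b : R,
  [/\ 0 < c, c ^+ 2 < b,
    forall u, 0 <= u -> (\int[P]_w (X u w)%:E = (S1 * (c * u `^ alpha))%:E)%E,
    forall u, 0 <= u -> (\int[P]_w (X u w * X u w)%:E =
      (S2 * (c * u `^ alpha) + S1 ^+ 2 * (b * (u `^ alpha) ^+ 2))%:E)%E &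
    forall u v, 0 <= u -> u <= v -> exists2 r,
      (\int[P]_w (X u w * X v w)%:E = (S2 * (c * u `^ alpha) + S1 ^+ 2 * r)%:E)%E &
      b / 2 * (u `^ alpha) ^+ 2 + c ^+ 2 * (u `^ alpha * (v - u) `^ alpha) <= r
        <= b / 2 * (u `^ alpha) ^+ 2 + c ^+ 2 * (u `^ alpha * v `^ alpha)].
Proof.
have := fractionalX; rewrite /generalized_fractional_counting_process lt_eqF//.
move=> [countX [d' [T' [P' [M [D [gcpM stableD indep law]]]]]]].
have [c [b [c0 cb EY EYY EYuv]]] := inverse_stable_moments alpha_gt0 stableD alpha_lt1.
pose Y := inverse_process (fun t => D t).
pose Z := time_change (fun t => M t) Y.
have countM : counting_process (fun t => M t) by have [] := gcpM.
have Y0 t w : 0 <= Y t w := inverse_process_ge0 _ t w.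
have mY t : measurable_fun setT (Y t) := measurable_inverse_process stableD t.
have mZ t : 0 <= t -> measurable_fun setT (Z t).
  by move=> t0; apply: measurable_counting_time_change.
have S1_ge0 : 0 <= S1 by apply: sumr_ge0 => j _; rewrite mulr_ge0// ltW.
have S2_ge0 : 0 <= S2 by apply: sumr_ge0 => j _; rewrite mulr_ge0// ltW.
have Z0 t w : 0 <= t -> 0 <= Z t w.
  by move=> t0; apply: (counting_process_ge0 countM).
have mX t : 0 <= t -> measurable_fun setT (X t) by move=> _; exact: measurable_funPT.
have EX u : 0 <= u -> (\int[P]_w (X u w)%:E = \int[P']_w (Z u w)%:E)%E.
  move=> u0; pose h (z : R * R) : \bar R := `|z.1|%:E.
  have mh : measurable_fun [set: R * R] h.
    by apply/measurable_EFinP; apply: measurableT_comp => //; exact: normr_measurable.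
  have h0 z : (0 <= h z)%E by rewrite lee_fin.
  have := equal_in_law_integral2 law u0 u0 mX mZ mh h0; rewrite /h /= => H.
  transitivity (\int[P]_w `|X u w|%:E)%E.
    by apply: eq_integral => w _; rewrite ger0_norm// counting_process_ge0.
  by rewrite H; apply: eq_integral => w _; rewrite ger0_norm// Z0.
have EXX u v : 0 <= u -> 0 <= v ->
    (\int[P]_w (X u w * X v w)%:E = \int[P']_w (Z u w * Z v w)%:E)%E.
  move=> u0 v0; pose h (z : R * R) : \bar R := `|z.1 * z.2|%:E.
  have mh : measurable_fun [set: R * R] h.
    apply/measurable_EFinP; apply: measurableT_comp; first exact: normr_measurable.
    exact: measurable_funM.
  have h0 z : (0 <= h z)%E by rewrite lee_fin.
  have := equal_in_law_integral2 law u0 v0 mX mZ mh h0; rewrite /h /= => H.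
  transitivity (\int[P]_w `|X u w * X v w|%:E)%E.
    by apply: eq_integral => w _; rewrite ger0_norm// mulr_ge0// counting_process_ge0.
  by rewrite H; apply: eq_integral => w _; rewrite ger0_norm// mulr_ge0// Z0.
have EZuv u v : 0 <= u -> u <= v -> (\int[P']_w (Z u w * Z v w)%:E =
    S2%:E * \int[P']_w (Y u w)%:E + (S1 ^+ 2)%:E * \int[P']_w (Y u w * Y v w)%:E)%E.
  move=> u0 uv; have v0 := le_trans u0 uv.
  rewrite (time_change_mixed_moment countM)//.
  under eq_integral do rewrite (generalized_counting_process_mixed_moment lambda_gt0 gcpM)//.
  transitivity (\int[P']_w (S2%:E * (Y u w)%:E + (S1 ^+ 2)%:E * (Y u w * Y v w)%:E))%E.
    (* The minimum of [Y u] and [Y v] is replaced by [Y u] almost surely, namely where the path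
       exceeds [v]. *)
    apply: ge0_ae_eq_integral => //.
    - apply/measurable_EFinP; apply: measurable_funD; apply: measurable_funM => //.
        exact: measurable_minr.
      exact: measurable_funM.
    - apply: emeasurable_funD; apply: measurable_funeM; apply/measurable_EFinP => //.
      exact: measurable_funM.
    - move=> w _; rewrite lee_fin addr_ge0// mulr_ge0// ?sqr_ge0//.
        by rewrite le_min !Y0.
      by rewrite mulr_ge0 ?Y0.
    - by move=> w _; rewrite -!EFinM -EFinD lee_fin addr_ge0 ?mulr_ge0 ?sqr_ge0.
    apply: filterS (subordinator_unbounded stableD v) => w vD _.
    by rewrite min_l ?EFinD ?EFinM//; exact: inverse_process_nd.
  rewrite ge0_integralD//.
  - rewrite !ge0_integralZl ?lee_fin ?sqr_ge0//.
    + by apply/measurable_EFinP; exact: measurable_funM.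
    + by move=> w _; rewrite lee_fin mulr_ge0.
    + exact/measurable_EFinP.
    + by move=> w _; rewrite lee_fin.
  - by move=> w _; rewrite -EFinM lee_fin mulr_ge0.
  - by apply: measurable_funeM; exact/measurable_EFinP.
  - by move=> w _; rewrite -EFinM lee_fin !mulr_ge0 ?sqr_ge0.
  - by apply: measurable_funeM; apply/measurable_EFinP; exact: measurable_funM.
exists c, b; split => //.
- move=> u u0; rewrite EX// (time_change_mean countM)//.
  under eq_integral do rewrite (generalized_counting_process_mean lambda_gt0 gcpM)// EFinM.
  rewrite ge0_integralZl//; first by rewrite EY// -EFinM.
  + exact/measurable_EFinP.
  + by move=> w _; rewrite lee_fin.
- by move=> u u0; rewrite EXX// EZuv// EY// EYY// -!EFinM -EFinD.
- move=> u v u0 uv; have v0 := le_trans u0 uv; have [r Er rb] := EYuv u v u0 uv.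
  by exists r => //; rewrite EXX// EZuv// EY// Er -!EFinM -EFinD.
Qed.

End fractional_moments.

(** * Asymptotics *)

Section real_asymptotics.
Context {R : realType}.

Lemma equiv_powR_cvg (f : R -> R) (c p : R) :
  f ~_(pinfty_nbhs R) (fun t => c * t `^ p) ->
  f t / t `^ p @[t --> +oo] --> c.
Proof.
move=> /eqaddoP H; apply/cvgrPdist_le => e e0.
have c1 : 0 < `|c| + 1 by rewrite ltr_wpDl.
have := H (e / (`|c| + 1)) (divr_gt0 e0 c1).
apply: filterS2 (nbhs_pinfty_gt (num_real 0)) => t t0.
have tp : 0 < t `^ p by rewrite powR_gt0.
rewrite /= !fctE normrM (ger0_norm (ltW tp)) => Ht.
have E : f t / t `^ p - c = (f t - c * t `^ p) / t `^ p.
  by rewrite mulrBl mulfK// gt_eqF.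
rewrite distrC E normrM normfV (ger0_norm (ltW tp)) ler_pdivrMr//.
apply: (le_trans Ht); rewrite mulrA ler_pM2r//.
by rewrite mulrAC ler_pdivrMr// ler_pM2l// lerDl.
Qed.

Lemma cvg_equiv_powR (f : R -> R) (c p : R) : c != 0 ->
  f t / t `^ p @[t --> +oo] --> c ->
  f ~_(pinfty_nbhs R) (fun t => c * t `^ p).
Proof.
move=> c0 /cvgrPdist_le H; apply/eqaddoP => e e0.
have ec : 0 < e * `|c| by rewrite mulr_gt0// normr_gt0.
have := H _ ec; apply: filterS2 (nbhs_pinfty_gt (num_real 0)) => t t0.
have tp : 0 < t `^ p by rewrite powR_gt0.
rewrite /= !fctE normrM (ger0_norm (ltW tp)).
have E : f t / t `^ p - c = (f t - c * t `^ p) / t `^ p.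
  by rewrite mulrBl mulfK// gt_eqF.
rewrite distrC E normrM normfV.
by rewrite (ger0_norm (ltW tp)) ler_pdivrMr// mulrA.
Qed.

(* The error term [expR (- v)] is evaluated by the Laplace transform of a
   subordinator: this avoids any law of large numbers. *)
Lemma powR_increment (alpha p e : R) : 0 < alpha -> alpha < 1 -> 0 <= p -> 0 < e ->
  exists2 C : R, 0 <= C & forall u v, 0 <= u -> u <= v ->
    u `^ p * v `^ alpha <=
    u `^ p * (v - u) `^ alpha + (e * u `^ (p + 1) + C * expR (- v)).
Proof.
(* [K] is the threshold above which [v^alpha <= e * v]. Below it the left-hand side is at most
   [K^p * K^alpha], and [expR (K - v) >= 1] pays for it. *)
move=> a0 a1 p0 e0; pose K := e^-1 `^ (1 - alpha)^-1.
have b0 : 0 < 1 - alpha by rewrite subr_gt0.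
have K0 : 0 < K by apply: powR_gt0; rewrite invr_gt0.
exists (K `^ p * K `^ alpha * expR K).
  by rewrite !mulr_ge0 ?powR_ge0 ?expR_ge0.
move=> u v u0 uv; have v0 := le_trans u0 uv.
have up0 : 0 <= u `^ p by exact: powR_ge0.
have [vK|Kv] := ltP v K.
  have H : u `^ p * v `^ alpha <= K `^ p * K `^ alpha * expR K * expR (- v).
    rewrite -[leLHS]mulr1 -[leRHS]mulrA ler_pM ?mulr_ge0 ?powR_ge0//.
      apply: ler_pM; rewrite ?powR_ge0//.
        by rewrite ge0_ler_powR ?nnegrE// ?(ltW K0)// (le_trans uv (ltW vK)).
      by rewrite ge0_ler_powR ?nnegrE// ?(ltW K0)// ltW.
    by rewrite -expRD -expR0 ler_expR subr_ge0 ltW.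
  apply: (le_trans H); rewrite addrA lerDr addr_ge0// mulr_ge0 ?powR_ge0//.
  exact: ltW.
have v_gt0 : 0 < v := lt_le_trans K0 Kv.
have vE : v = v `^ alpha * v `^ (1 - alpha).
  have a1E : alpha + (1 - alpha) = 1 by rewrite addrC subrK.
  by rewrite -powRD a1E ?powRr1// oner_eq0.
have ev : e^-1 <= v `^ (1 - alpha).
  have -> : e^-1 = K `^ (1 - alpha).
    by rewrite /K -powRrM mulVf ?powRr1 ?gt_eqF// invr_ge0 ltW.
  by rewrite ge0_ler_powR ?nnegrE// ltW.
have va : v `^ alpha <= e * v.
  rewrite [in leRHS]vE mulrCA -[leLHS]mulr1 ler_pM2l ?powR_gt0//.
  by rewrite -ler_pdivrMl// mulr1.
(* As [z <= z^alpha] on [[0, 1]], the difference [v^alpha - (v - u)^alpha] is at most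
   [v^alpha * (1 - z)], hence at most [e * v * (u / v) = e * u]. *)
pose z := 1 - u / v.
have z0 : 0 <= z by rewrite subr_ge0 ler_pdivrMr// mul1r.
have z1 : z <= 1 by rewrite lerBlDr lerDl divr_ge0.
have zz : z <= z `^ alpha.
  have [->|z_neq0] := eqVneq z 0; first exact: powR_ge0.
  have z_gt0 : 0 < z by rewrite lt_neqAle eq_sym z_neq0.
  by rewrite ger1_powR ?z_gt0// ltW.
have vu : v - u = v * z by rewrite /z mulrBr mulr1 mulrCA divff ?mulr1// gt_eqF.
have uz : u = v * (1 - z) by rewrite /z subKr mulrCA divff ?mulr1// gt_eqF.
have H : v `^ alpha <= (v - u) `^ alpha + e * u.
  rewrite vu powRM//.
  have H1 : v `^ alpha * z <= v `^ alpha * z `^ alpha by rewrite ler_wpM2l// powR_ge0.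
  have H2 : v `^ alpha * (1 - z) <= e * v * (1 - z) by rewrite ler_wpM2r// subr_ge0.
  by rewrite [in leRHS]uz; lra.
have := ler_wpM2l up0 H; rewrite mulrDr => /le_trans; apply.
rewrite lerD2l powRD ?powRr1//; last by rewrite gt_eqF ?implybT// ltr_wpDl.
rewrite mulrCA lerDl !mulr_ge0 ?powR_ge0 ?expR_ge0//.
Qed.

End real_asymptotics.

(** * Subordinated processes *)

Section covariance_ge0.
Context {R : realType} d (T : measurableType d) (P : probability T R).

Lemma ge0_Lfun1 (X : T -> R) (r : R) : measurable_fun setT X ->
  (forall w, 0 <= X w) -> (\int[P]_w (X w)%:E = r%:E)%E -> X \in Lfun P 1.
Proof.
move=> mX X0 Xr; apply/Lfun1_integrable/integrableP; split.
  exact/measurable_EFinP.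
under eq_integral do rewrite /= ger0_norm//.
by rewrite Xr ltry.
Qed.

Lemma covariance_ge0E (X Y : T -> R) (mx my r : R) :
  measurable_fun setT X -> measurable_fun setT Y ->
  (forall w, 0 <= X w) -> (forall w, 0 <= Y w) ->
  (\int[P]_w (X w)%:E = mx%:E)%E -> (\int[P]_w (Y w)%:E = my%:E)%E ->
  (\int[P]_w (X w * Y w)%:E = r%:E)%E ->
  covariance P X Y = (r - mx * my)%:E.
Proof.
move=> mX mY X0 Y0 EX EY EXY; rewrite covarianceE.
- by rewrite unlock EX EY -EFinM EFinB; congr (_ - _)%E.
- exact: (ge0_Lfun1 mX X0 EX).
- exact: (ge0_Lfun1 mY Y0 EY).
- apply: (ge0_Lfun1 _ _ EXY); first exact: measurable_funM.
  by move=> w; rewrite mulr_ge0.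
Qed.

End covariance_ge0.

(** * Power moments of a subordinator *)

Section subordinator_moments.
Context {R : realType} d (T : measurableType d) (P : probability T R).
Variables (f : R -> R) (D : R -> {RV P >-> R}).
Hypothesis subD : subordinator f D.
Hypothesis finite_moments : forall r t : R, 0 < r -> 0 <= t ->
  ('E_P[(fun w => D t w `^ r)%R] < +oo)%E.

Let levyD : levy_process D := subordinator_levy subD.
Let D_ge0 t w : 0 <= t -> 0 <= D t w := subordinator_ge0 subD w.
Let D_nd s t w : 0 <= s -> s <= t -> D s w <= D t w :=
  subordinator_nondecreasing subD w.

Definition power_moment (r t : R) : R := fine (\int[P]_w (D t w `^ r)%:E)%E.

Let mom := power_moment.

Lemma measurable_powR_comp (X : T -> R) r : measurable_fun setT X ->
  measurable_fun setT (fun w => X w `^ r).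
Proof. by move=> mX; exact: (measurableT_comp (@measurable_powR R r) mX). Qed.

Lemma power_momentE r t : 0 < r -> 0 <= t ->
  (\int[P]_w (D t w `^ r)%:E = (power_moment r t)%:E)%E.
Proof.
move=> r0 t0; rewrite fineK// ge0_fin_numE.
  by have := finite_moments r0 t0; rewrite unlock.
by apply: integral_ge0 => w _; rewrite lee_fin powR_ge0.
Qed.

Lemma power_moment_ge0 r t : 0 <= power_moment r t.
Proof. by apply/fine_ge0/integral_ge0 => w _; rewrite lee_fin powR_ge0. Qed.

Let laplace s t : 0 < s -> 0 <= t ->
  (\int[P]_w (expR (- s * D t w))%:E = (expR (- t * f s))%:E)%E.
Proof. by move=> s0 t0; have := subordinator_laplace subD s0 t0; rewrite unlock. Qed.

Let D_le s t w : 0 <= s -> s <= t -> 0 <= D t w - D s w.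
Proof. by move=> s0 st; rewrite subr_ge0 D_nd. Qed.

Lemma power_moment_increment r s t : 0 <= s -> s <= t ->
  (\int[P]_w ((D t w - D s w) `^ r)%:E = \int[P]_w (D (t - s) w `^ r)%:E)%E.
Proof.
move=> s0 st; have ts0 : 0 <= t - s by rewrite subr_ge0.
have mh : measurable_fun setT (fun x : R => (x `^ r)%:E : \bar R).
  by apply/measurable_EFinP; exact: measurable_powR.
have h0 (x : R) : (0 <= (x `^ r)%:E :> \bar R)%E by rewrite lee_fin powR_ge0.
by have := levy_increment_integral levyD s0 ts0 mh h0; rewrite [s + _]addrC subrK.
Qed.

Lemma power_moment_indep r q s t : 0 < r -> 0 < q -> 0 <= s -> s <= t ->
  (\int[P]_w (D s w `^ r * (D t w - D s w) `^ q)%:E =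
   (power_moment r s * power_moment q (t - s))%:E)%E.
Proof.
move=> r0 q0 s0 st; have ts0 : 0 <= t - s by rewrite subr_ge0.
rewrite EFinM -(power_momentE r0 s0) -(power_momentE q0 ts0) -(power_moment_increment q s0 st).
apply: (@integralM_indep _ _ _ P (fun w => D s w `^ r) (fun w => (D t w - D s w) `^ q)).
- exact: measurable_powR_comp.
- by apply: measurable_powR_comp; exact: measurable_funB.
- by move=> w; exact: powR_ge0.
- by move=> w; exact: powR_ge0.
move=> A B mA mB.
have mpow p C : measurable C -> measurable ((@powR R ^~ p) @^-1` C).
  by move=> mC; rewrite -[X in measurable X]setTI; exact: measurable_powR.
have := levy_increment_indep levyD s0 ts0 (mpow r A mA) (mpow q B mB).
rewrite -(levy_increment_law levyD s0 ts0 (mpow q B mB)).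
by rewrite [s + (t - s)]addrC subrK.
Qed.

Lemma power_moment1D s t : 0 <= s -> 0 <= t ->
  power_moment 1 (s + t) = power_moment 1 s + power_moment 1 t.
Proof.
move=> s0 t0; have st0 : 0 <= s + t by rewrite addr_ge0.
have sst : s <= s + t by rewrite lerDl.
apply: EFin_inj; rewrite EFinD -(power_momentE ltr01 st0).
rewrite -(power_momentE ltr01 s0) -(power_momentE ltr01 t0).
have -> : (\int[P]_w (D t w `^ 1)%:E = \int[P]_w ((D (s + t) w - D s w) `^ 1)%:E)%E.
  by rewrite (power_moment_increment 1 s0 sst) [s + t]addrC addrK.
rewrite -ge0_integralD//.
- apply: eq_integral => w _; rewrite !powRr1 ?D_ge0 ?D_le// -EFinD.
  by rewrite [D s w + _]addrC subrK.
- by move=> w _; rewrite lee_fin powR_ge0.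
- by apply/measurable_EFinP; exact: measurable_powR_comp.
- by move=> w _; rewrite lee_fin powR_ge0.
- by apply/measurable_EFinP; apply: measurable_powR_comp; exact: measurable_funB.
Qed.

Lemma power_moment_sqr_le r t : 0 < r -> 0 <= t ->
  power_moment r t ^+ 2 <= power_moment (2 * r) t.
Proof.
move=> r0 t0; have r20 : 0 < 2 * r by rewrite mulr_gt0.
have mX : measurable_fun setT (fun w => D t w `^ r) by exact: measurable_powR_comp.
have X0 w : 0 <= D t w `^ r by exact: powR_ge0.
have EX := power_momentE r0 t0.
have EXX : (\int[P]_w (D t w `^ r * D t w `^ r)%:E = (power_moment (2 * r) t)%:E)%E.
  rewrite -power_momentE//; apply: eq_integral => w _; congr (_%:E).
  by rewrite [2 * r]mulrC powRrM powR_mulrn// expr2.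
have := variance_ge0 P (fun w => D t w `^ r).
rewrite /variance (covariance_ge0E mX mX X0 X0 EX EX EXX) lee_fin subr_ge0.
by rewrite expr2.
Qed.

Section laplace_exponent.
Variable t1 : R.
Variable r : R.
Hypotheses (t1_ge0 : 0 <= t1) (r_gt0 : 0 < r) (mom_gt0 : 0 < power_moment r t1).

Let D_eq0 t : 0 <= t -> 1 <= expR (- t * f 1) -> {ae P, forall w, D t w = 0}.
Proof.
move=> t0 ft; have := laplace ltr01 t0.
have e01 w : 0 <= expR (- 1 * D t w) <= 1.
  by rewrite expR_ge0 -[leRHS]expR0 ler_expR mulN1r oppr_le0 D_ge0.
have me : measurable_fun setT (fun w => expR (- 1 * D t w)).
  by apply: measurableT_comp => //; exact: measurable_funM.
have m1e : measurable_fun setT (fun w => (1 - expR (- 1 * D t w))%:E : \bar R).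
  by apply/measurable_EFinP; exact: measurable_funB.
have e1 w : (0 <= (1 - expR (- 1 * D t w))%:E :> \bar R)%E.
  by rewrite lee_fin subr_ge0; have /andP[] := e01 w.
have E1 : (\int[P]_w (1 - expR (- 1 * D t w))%:E + \int[P]_w (expR (- 1 * D t w))%:E = 1)%E.
  rewrite -ge0_integralD//; last exact/measurable_EFinP.
  under eq_integral do rewrite -EFinD subrK.
  by rewrite (integral_cst P measurableT 1) mul1e; exact: probability_setT.
move=> lap; rewrite lap in E1.
have V0 : (\int[P]_w `|(1 - expR (- 1 * D t w))%:E| = 0)%E.
  under eq_integral do rewrite gee0_abs ?e1//.
  apply/eqP; rewrite eq_le; apply/andP; split; last by apply: integral_ge0.
  rewrite -(leeD2rE _ _ (isT : (expR (- t * f 1))%:E \is a fin_num)) E1 add0e lee_fin.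
  exact: ft.
have [/(_ V0) + _] := ae_eq_integral_abs P measurableT m1e.
apply: filterS => w /(_ I)[] /eqP; rewrite subr_eq0 => /eqP e1w.
have /expR_inj/eqP : expR (- 1 * D t w) = expR 0 by rewrite expR0.
by rewrite mulN1r oppr_eq0 => /eqP.
Qed.

Let mom_eq0 t : 0 <= t -> {ae P, forall w, D t w = 0} -> power_moment r t = 0.
Proof.
move=> t0 D0; apply: EFin_inj; rewrite -power_momentE//.
rewrite (@ge0_ae_eq_integral _ _ _ P setT _ (cst 0%E))//.
- by rewrite integral0.
- by apply/measurable_EFinP; exact: measurable_powR_comp.
- by move=> w _; rewrite lee_fin powR_ge0.
- by apply: filterS D0 => w -> _; rewrite powR0// gt_eqF.
Qed.

(** Otherwise the Laplace transform at 1 would be at least 1 at time [t1], forcing [D t1 = 0] almost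
    surely against its positive moment. Positivity of [f 1] makes the error terms [expR (- t * f 1)]
    decay. *)
Lemma laplace_exponent_gt0 : 0 < f 1.
Proof.
rewrite ltNge; apply/negP => f0; move: mom_gt0; rewrite mom_eq0 ?ltxx//.
by apply: D_eq0 => //; rewrite -[leLHS]expR0 ler_expR mulNr oppr_ge0 mulr_ge0_le0.
Qed.

(** If [D t] vanished almost surely, its Laplace transform at 1 would give [t * f 1 = 0]. *)
Lemma power_moment_gt0 t : 0 < t -> 0 < power_moment r t.
Proof.
move=> t0; rewrite lt_neqAle power_moment_ge0 andbT; apply/negP => /eqP m0.
have : {ae P, forall w, D t w = 0}.
  have mX : measurable_fun setT (fun w => (D t w `^ r)%:E : \bar R).
    by apply/measurable_EFinP; exact: measurable_powR_comp.
  have V0 : (\int[P]_w `|(D t w `^ r)%:E| = 0)%E.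
    under eq_integral do rewrite gee0_abs ?lee_fin ?powR_ge0//.
    by rewrite power_momentE// ?ltW// -m0.
  have [/(_ V0) + _] := ae_eq_integral_abs P measurableT mX.
  by apply: filterS => w /(_ I)[]; exact: powR_eq0_eq0.
move=> D0; have := laplace ltr01 (ltW t0).
rewrite (@ge0_ae_eq_integral _ _ _ P setT _ (cst 1%E))//; last 2 first.
- by apply/measurable_EFinP; apply: measurableT_comp => //; exact: measurable_funM.
- by apply: filterS D0 => w -> _; rewrite mulr0 expR0.
rewrite (integral_cst P measurableT 1%E) mul1e.
rewrite [X in X = _ -> _](_ : _ = 1%E); last exact: probability_setT.
move=> [e1]; have /expR_inj/eqP : expR (- t * f 1) = expR 0 by rewrite expR0.
rewrite mulNr oppr_eq0 mulf_eq0 !gt_eqF//.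
exact: laplace_exponent_gt0.
Qed.

End laplace_exponent.
End subordinator_moments.

Lemma integral_lincomb {R : realType} d (T : measurableType d)
    (P : probability T R) (x y g h : R) (G H : T -> R) :
  0 <= x -> 0 <= y -> measurable_fun setT G -> measurable_fun setT H ->
  (forall w, 0 <= G w) -> (forall w, 0 <= H w) ->
  (\int[P]_w (G w)%:E = g%:E)%E -> (\int[P]_w (H w)%:E = h%:E)%E ->
  (\int[P]_w (x * G w + y * H w)%:E = (x * g + y * h)%:E)%E.
Proof.
move=> x0 y0 mG mH G0 H0 EG EH; under eq_integral do rewrite EFinD.
rewrite ge0_integralD//.
- under eq_integral do rewrite EFinM.
  rewrite ge0_integralZl//; last 2 first.
  + exact/measurable_EFinP.
  + by move=> w _; rewrite lee_fin.
  under [X in (_ + X)%E]eq_integral do rewrite EFinM.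
  rewrite ge0_integralZl//; last 2 first.
  + exact/measurable_EFinP.
  + by move=> w _; rewrite lee_fin.
  by rewrite EG EH -!EFinM -EFinD.
- by move=> w _; rewrite lee_fin mulr_ge0.
- by apply/measurable_EFinP; exact: measurable_funM.
- by move=> w _; rewrite lee_fin mulr_ge0.
- by apply/measurable_EFinP; exact: measurable_funM.
Qed.

(** * Mixed moments of the time-changed process *)

Section subordinated_covariance.
Context {R : realType} d (T : measurableType d) (P : probability T R).
Variables (k : nat) (lambda : 'I_k -> R) (alpha : R) (f : R -> R).
Variables (D M : R -> {RV P >-> R}).
Hypotheses (k_gt0 : (0 < k)%N) (lambda_gt0 : forall j, 0 < lambda j).
Hypotheses (alpha_gt0 : 0 < alpha) (alpha_lt1 : alpha < 1).
Hypothesis subD : subordinator f D.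
Hypothesis finite_moments : forall r t : R, 0 < r -> 0 <= t ->
  ('E_P[(fun w => D t w `^ r)%R] < +oo)%E.
Hypothesis fractionalM : generalized_fractional_counting_process alpha lambda M.
Hypothesis indep : independent_processes P (fun t => M t) (fun t => D t).

Let D_ge0 t w : 0 <= t -> 0 <= D t w := subordinator_ge0 subD w.
Let D_nd s t w : 0 <= s -> s <= t -> D s w <= D t w :=
  subordinator_nondecreasing subD w.

Let Z := time_change (fun t => M t) (fun t => D t).
Let S1 := jump_moment lambda 1.
Let S2 := jump_moment lambda 2.
Let mom := power_moment D.

Let countM : counting_process (fun t => M t).
Proof.
by have := fractionalM; rewrite /generalized_fractional_counting_process lt_eqF// => -[].
Qed.

Let mD t : 0 <= t -> measurable_fun setT (D t). Proof. by []. Qed.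

Let mZ t : 0 <= t -> measurable_fun setT (Z t).
Proof. by move=> t0; exact: (measurable_counting_time_change countM). Qed.

Let Z_ge0 t w : 0 <= t -> 0 <= Z t w.
Proof. by move=> t0; apply: (counting_process_ge0 countM); exact: D_ge0. Qed.

Let mpow r t : measurable_fun setT (fun w => D t w `^ r).
Proof. exact: measurable_powR_comp. Qed.

Let mincr r s t : measurable_fun setT (fun w => (D t w - D s w) `^ r).
Proof. by apply: measurable_powR_comp; exact: measurable_funB. Qed.

(** [powR_increment] is integrated at [u = D s], [v = D t], the mean of [expR (- D t)] being
    [expR (- t * f 1)]. The case [p = 0] serves for the means and [p = alpha] for the mixed
    moments. *)
Lemma increment_integral_le (p s e : R) : 0 <= p -> 0 <= s -> 0 < e ->
  exists2 C : R, 0 <= C & forall t, s <= t ->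
    (\int[P]_w (D s w `^ p * D t w `^ alpha)%:E <=
     \int[P]_w (D s w `^ p * (D t w - D s w) `^ alpha)%:E +
     (e * mom (p + 1) s + C * expR (- t * f 1))%:E)%E.
Proof.
move=> p0 s0 e0; have [C C0 HC] := powR_increment alpha_gt0 alpha_lt1 p0 e0.
exists C => // t st; have t0 := le_trans s0 st.
have p1 : 0 < p + 1 by rewrite ltr_wpDl.
have mexp : measurable_fun setT (fun w => expR (- 1 * D t w)).
  by apply: measurableT_comp => //; exact: measurable_funM.
have lap : (\int[P]_w (expR (- 1 * D t w))%:E = (expR (- t * f 1))%:E)%E.
  by have := subordinator_laplace subD ltr01 t0; rewrite unlock.
rewrite EFinD EFinM -(power_momentE finite_moments)// EFinM -lap.
rewrite -ge0_integralZl//; last 3 first.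
- by apply/measurable_EFinP; exact: mpow.
- by move=> w _; rewrite lee_fin powR_ge0.
- by rewrite lee_fin ltW.
rewrite -ge0_integralZl//; last exact/measurable_EFinP.
have mA : measurable_fun setT (fun w => (D s w `^ p * (D t w - D s w) `^ alpha)%:E : \bar R).
  by apply/measurable_EFinP; apply: measurable_funM; [exact: mpow|exact: mincr].
have mB : measurable_fun setT (fun w => (e%:E * (D s w `^ (p + 1))%:E : \bar R)%E).
  by apply: measurable_funeM; apply/measurable_EFinP; exact: mpow.
have mC : measurable_fun setT (fun w => (C%:E * (expR (- 1 * D t w))%:E : \bar R)%E).
  by apply: measurable_funeM; exact/measurable_EFinP.
have A0 w : (0 <= (D s w `^ p * (D t w - D s w) `^ alpha)%:E :> \bar R)%E.
  by rewrite lee_fin mulr_ge0 ?powR_ge0.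
have B0 w : (0 <= e%:E * (D s w `^ (p + 1))%:E :> \bar R)%E.
  by rewrite -EFinM lee_fin mulr_ge0 ?powR_ge0// ltW.
have C1 w : (0 <= C%:E * (expR (- 1 * D t w))%:E :> \bar R)%E.
  by rewrite -EFinM lee_fin mulr_ge0 ?expR_ge0.
rewrite -ge0_integralD// -ge0_integralD//; last 2 first.
- by move=> w _; rewrite adde_ge0.
- exact: emeasurable_funD.
apply: ge0_le_integral => //.
- by move=> w _; rewrite lee_fin mulr_ge0 ?powR_ge0.
- by apply/measurable_EFinP; apply: measurable_funM; exact: mpow.
- by apply: emeasurable_funD => //; exact: emeasurable_funD.
- move=> w _; rewrite -!EFinM -!EFinD lee_fin mulN1r.
  by apply: HC; [exact: D_ge0|exact: D_nd].
Qed.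

Lemma power_moment_increment_le (s e : R) : 0 <= s -> 0 < e ->
  exists2 C : R, 0 <= C & forall t, s <= t ->
    mom alpha t <= mom alpha (t - s) + (e * mom 1 s + C * expR (- t * f 1)).
Proof.
move=> s0 e0; have [C C0 HC] := increment_integral_le (lexx 0) s0 e0.
exists C => // t st; have t0 := le_trans s0 st; have := HC t st.
under eq_integral do rewrite powRr0 mul1r.
rewrite (power_momentE finite_moments)// add0r.
under eq_integral do rewrite powRr0 mul1r.
rewrite (power_moment_increment subD)// (power_momentE finite_moments) ?subr_ge0//.
Qed.

Lemma power_moment_mixed_le (s e : R) : 0 <= s -> 0 < e ->
  exists2 C : R, 0 <= C & forall t, s <= t ->
    (\int[P]_w (D s w `^ alpha * D t w `^ alpha)%:E <=
     (mom alpha s * mom alpha (t - s) +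
      (e * mom (alpha + 1) s + C * expR (- t * f 1)))%:E)%E.
Proof.
move=> s0 e0; have [C C0 HC] := increment_integral_le (ltW alpha_gt0) s0 e0.
exists C => // t st; apply: (le_trans (HC t st)).
by rewrite (power_moment_indep subD finite_moments)// -EFinD.
Qed.

Lemma power_moment_nd r s t : 0 < r -> 0 <= s -> s <= t -> mom r s <= mom r t.
Proof.
move=> r0 s0 st; have t0 := le_trans s0 st.
rewrite -lee_fin -(power_momentE finite_moments r0 s0) -(power_momentE finite_moments r0 t0).
apply: ge0_le_integral => //.
- by move=> w _; rewrite lee_fin powR_ge0.
- by apply/measurable_EFinP; exact: mpow.
- by apply/measurable_EFinP; exact: mpow.
- move=> w _; rewrite lee_fin; apply: ge0_ler_powR; rewrite ?nnegrE.
  + exact: ltW.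
  + exact: D_ge0.
  + exact: D_ge0.
  + exact: D_nd.
Qed.

Let sqr_powR t w : (D t w `^ alpha) ^+ 2 = D t w `^ (2 * alpha).
Proof. by rewrite [2 * alpha]mulrC powRrM powR_mulrn// powR_ge0. Qed.

(** [r] is the part of the mixed moment that is only known by bounds. Its lower bound factors
    because [D t - D s] is independent of [D s]; its upper bound is brought back to the same
    product, up to a small error, by [power_moment_mixed_le]. *)
Lemma subordinated_moments : exists c b : R,
  [/\ 0 < c, c ^+ 2 < b,
    forall t, 0 <= t -> (\int[P]_w (Z t w)%:E = (S1 * (c * mom alpha t))%:E)%E,
    forall t, 0 <= t -> (\int[P]_w (Z t w * Z t w)%:E =
      (S2 * (c * mom alpha t) + S1 ^+ 2 * (b * mom (2 * alpha) t))%:E)%E &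
    forall s t, 0 <= s -> s <= t -> exists2 r,
      (\int[P]_w (Z s w * Z t w)%:E =
        (S2 * (c * mom alpha s) + S1 ^+ 2 * (b / 2 * mom (2 * alpha) s) +
         (S1 * c) ^+ 2 * r)%:E)%E &
      mom alpha s * mom alpha (t - s) <= r /\
      (r%:E <= \int[P]_w (D s w `^ alpha * D t w `^ alpha)%:E)%E].
Proof.
have [c [b [c0 cb EX EXX EXuv]]] :=
  fractional_counting_moments lambda_gt0 alpha_gt0 alpha_lt1 fractionalM.
have S1_gt0 : 0 < S1 by exact: jump_moment_gt0.
have S2_gt0 : 0 < S2 by exact: jump_moment_gt0.
have a2_gt0 : 0 < 2 * alpha by rewrite mulr_gt0.
have b_gt0 : 0 < b by apply: le_lt_trans cb; exact: sqr_ge0.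
have P0 r t w : 0 <= D t w `^ r by exact: powR_ge0.
exists c, b; split => //.
- move=> t t0; rewrite (time_change_mean countM)//.
  under eq_integral do rewrite EX ?D_ge0// mulrA.
  under eq_integral do rewrite EFinM.
  rewrite ge0_integralZl//.
  + by rewrite (power_momentE finite_moments)// -EFinM mulrA.
  + by apply/measurable_EFinP; exact: mpow.
  + by move=> w _; rewrite lee_fin.
  + by rewrite lee_fin mulr_ge0// ltW.
- move=> t t0; rewrite (time_change_mixed_moment countM)//.
  under eq_integral do rewrite EXX ?D_ge0// sqr_powR [S2 * _]mulrA [S1 ^+ 2 * _]mulrA.
  rewrite (integral_lincomb _ _ _ _ _ _ (power_momentE finite_moments alpha_gt0 t0)
    (power_momentE finite_moments a2_gt0 t0)) ?mulrA// ?mulr_ge0 ?sqr_ge0 ?ltW//;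
    exact: mpow.
move=> s t s0 st; have t0 := le_trans s0 st.
pose base := S2 * (c * mom alpha s) + S1 ^+ 2 * (b / 2 * mom (2 * alpha) s).
pose mst := (\int[P]_w (D s w `^ alpha * D t w `^ alpha)%:E)%E.
have mst_fin : mst = (fine mst)%:E.
  rewrite fineK// ge0_fin_numE; last first.
    by apply: integral_ge0 => w _; rewrite lee_fin mulr_ge0.
  have [C _ /(_ t st) H] := power_moment_mixed_le s0 (@ltr01 R).
  exact: (le_lt_trans H (ltry _)).
have mprod : measurable_fun setT (fun w => D s w `^ alpha * D t w `^ alpha).
  by apply: measurable_funM; exact: mpow.
have mincr' : measurable_fun setT (fun w => D s w `^ alpha * (D t w - D s w) `^ alpha).
  by apply: measurable_funM; [exact: mpow|exact: mincr].
pose F w := S2 * c * D s w `^ alpha + S1 ^+ 2 * (b / 2) * D s w `^ (2 * alpha).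
have Sc_ge0 : 0 <= S2 * c by rewrite mulr_ge0 ?ltW.
have Sb_ge0 : 0 <= S1 ^+ 2 * (b / 2) by rewrite mulr_ge0 ?sqr_ge0 ?divr_ge0 ?ltW.
have F_ge0 w : 0 <= F w by rewrite addr_ge0// mulr_ge0.
have mF : measurable_fun setT F.
  by apply: measurable_funD; apply: measurable_funM => //; exact: mpow.
have EF : (\int[P]_w (F w)%:E = base%:E)%E.
  rewrite /base [S2 * _]mulrA [S1 ^+ 2 * _]mulrA.
  apply: integral_lincomb => //; try exact: mpow.
  - exact: (power_momentE finite_moments).
  - exact: (power_momentE finite_moments).
have S1c_gt0 : 0 < (S1 * c) ^+ 2 by rewrite exprn_gt0// mulr_gt0.
have EFG (G : T -> R) g : measurable_fun setT G -> (forall w, 0 <= G w) ->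
    (\int[P]_w (G w)%:E = g%:E)%E ->
    (\int[P]_w (1 * F w + (S1 * c) ^+ 2 * G w)%:E = (base + (S1 * c) ^+ 2 * g)%:E)%E.
  move=> mG G0 EG; rewrite (integral_lincomb _ _ mF mG F_ge0 G0 EF EG) ?mul1r//.
  exact: ltW.
have EZZ := time_change_mixed_moment countM mD D_ge0 indep s0 t0.
have mG := measurable_conditional_mixed_moment countM mD D_ge0 s0 t0.
have M_ge0 u v w : 0 <= u -> 0 <= v -> (0 <= (M u w * M v w)%:E :> \bar R)%E.
  by move=> u0 v0; rewrite lee_fin mulr_ge0 ?(counting_process_ge0 countM).
have bounds w : exists2 r,
    (\int[P]_w1 (M (D s w) w1 * M (D t w) w1)%:E = r%:E)%E &
    1 * F w + (S1 * c) ^+ 2 * (D s w `^ alpha * (D t w - D s w) `^ alpha) <= r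
    <= 1 * F w + (S1 * c) ^+ 2 * (D s w `^ alpha * D t w `^ alpha).
  have [r -> /andP[r1 r2]] := EXuv _ _ (D_ge0 w s0) (D_nd w s0 st).
  eexists; first reflexivity.
  have S12 : 0 <= S1 ^+ 2 by exact: sqr_ge0.
  have := ler_wpM2l S12 r1; have := ler_wpM2l S12 r2.
  rewrite /F -sqr_powR -/S1 -/S2 exprMn => h2 h1.
  by apply/andP; split; lra.
have lo : ((base + (S1 * c) ^+ 2 * (mom alpha s * mom alpha (t - s)))%:E <=
    \int[P]_w (Z s w * Z t w)%:E)%E.
  rewrite EZZ -(EFG _ _ mincr' _
    (power_moment_indep subD finite_moments alpha_gt0 alpha_gt0 s0 st)); last first.
    by move=> w; rewrite mulr_ge0 ?powR_ge0.
  apply: ge0_le_integral => //.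
  - by move=> w _; rewrite lee_fin addr_ge0 ?mul1r// mulr_ge0 ?mulr_ge0 ?powR_ge0// ltW.
  - by apply/measurable_EFinP; apply: measurable_funD; exact: measurable_funM.
  - by move=> w _; have [r -> /andP[r1 _]] := bounds w; rewrite lee_fin.
have up : (\int[P]_w (Z s w * Z t w)%:E <= (base + (S1 * c) ^+ 2 * fine mst)%:E)%E.
  rewrite EZZ -(EFG _ _ mprod _ mst_fin); last by move=> w; rewrite mulr_ge0.
  apply: ge0_le_integral => //.
  - by move=> w _; apply: integral_ge0 => w1 _; rewrite M_ge0 ?D_ge0.
  - by apply/measurable_EFinP; apply: measurable_funD; exact: measurable_funM.
  - by move=> w _; have [r -> /andP[_ r2]] := bounds w; rewrite lee_fin.
have ZZ_fin : (\int[P]_w (Z s w * Z t w)%:E)%E \is a fin_num.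
  rewrite ge0_fin_numE; first exact: (le_lt_trans up (ltry _)).
  by apply: integral_ge0 => w _; rewrite lee_fin mulr_ge0 ?Z_ge0.
move: lo up; rewrite -(fineK ZZ_fin) !lee_fin; set N := fine _ => lo up.
exists ((N - base) / (S1 * c) ^+ 2).
  by congr (_%:E); rewrite [X in _ + X]mulrC divfK ?gt_eqF// -/base addrC subrK.
split; first by rewrite ler_pdivlMr// mulrC lerBrDl.
by rewrite -/mst mst_fin lee_fin ler_pdivrMr// [leRHS]mulrC lerBlDl.
Qed.
End subordinated_covariance.

(** * Limits at infinity *)

Section limits.
Context {R : realType}.

(** [K] may depend on [e], as do the constants of [powR_increment]: [e] is fixed before the
    exponential is made small. *)
Lemma cvg_exp_bound (g : R -> R) (l a s : R) : 0 < a ->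
  (forall e, 0 < e -> exists K, forall t, s <= t ->
    `|l - g t| <= e + K * expR (- t * a)) ->
  g t @[t --> +oo] --> l.
Proof.
move=> a0 H; apply/cvgrPdist_le => e e0; have e20 : 0 < e / 2 by rewrite divr_gt0.
have [K HK] := H _ e20; pose K' := `|K| + 1.
have K'0 : 0 < K' by rewrite ltr_wpDl.
pose t1 := - ln (e / 2 / K') / a.
apply: filterS2 (nbhs_pinfty_ge (num_real s)) (nbhs_pinfty_ge (num_real t1)) => t st tt1.
apply: (le_trans (HK t st)); rewrite [leRHS]splitr lerD2l.
apply: (@le_trans _ _ (K' * expR (- t * a))).
  by rewrite ler_pM2r ?expR_gt0// (le_trans (ler_norm K))// lerDl.
rewrite mulrC -ler_pdivlMr// -[leRHS]lnK ?posrE ?divr_gt0// ler_expR.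
by rewrite mulNr lerNl -ler_pdivrMr.
Qed.

Lemma cvg_powRN_pinfty (theta : R) : 0 < theta -> (t `^ theta)^-1 @[t --> +oo] --> (0 : R).
Proof.
move=> theta0; apply/cvgrPdist_le => e e0; pose t1 := e^-1 `^ theta^-1.
have t10 : 0 < t1 by apply: powR_gt0; rewrite invr_gt0.
apply: filterS (nbhs_pinfty_ge (num_real t1)) => t tt1.
have t0 := lt_le_trans t10 tt1.
rewrite sub0r normrN ger0_norm ?invr_ge0 ?powR_ge0// -[leRHS]invrK.
rewrite lef_pV2 ?posrE ?invr_gt0 ?powR_gt0//.
have -> : e^-1 = t1 `^ theta by rewrite /t1 -powRrM mulVf ?gt_eqF// powRr1// invr_ge0 ltW.
by rewrite ge0_ler_powR ?nnegrE// ltW.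
Qed.

(** Doubling [t] multiplies [u t / t^theta] by [l = 2^(1 - theta) > 1], so that the limit would
    satisfy [c = l * c]. *)
Lemma linear_not_equiv_powR (u : R -> R) (theta c : R) : theta < 1 -> 0 < c ->
  (forall t, 0 <= t -> u (t + t) = u t + u t) ->
  ~ (u t / t `^ theta @[t --> +oo] --> c).
Proof.
move=> theta1 c0 uD /cvgrPdist_le H; pose l : R := 2 `^ (1 - theta).
have l1 : 1 < l.
  have e1 : 1 `^ (1 - theta) = 1 :> R by rewrite powR1.
  by rewrite -[ltLHS]e1 gt0_ltr_powR ?nnegrE ?subr_gt0 ?ltr1n.
have l20 : 0 < l + 2 by lra.
(* The estimates at [t] and [t + t] give [(l - 1) * c <= (l + 1) * e], which this choice of [e]
   contradicts. *)
pose e := (l - 1) * c / (l + 2).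
have e0 : 0 < e by rewrite divr_gt0// mulr_gt0// subr_gt0.
have eE : (l + 2) * e = (l - 1) * c by rewrite /e mulrC divfK// gt_eqF.
have [A [_ HA]] := H e e0; pose t := Num.max A 0 + 1.
have t0 : 0 < t by rewrite ltr_wpDl// le_max lexx orbT.
have At : A < t by rewrite (@le_lt_trans _ _ (Num.max A 0)) ?le_max ?lexx// ltrDl.
have Att : A < t + t by rewrite (lt_trans At)// ltrDl.
have := HA _ Att; have := HA _ At => /=.
have -> : u (t + t) / (t + t) `^ theta = l * (u t / t `^ theta).
  rewrite uD ?ltW// -mulr2n -[t + t]mulr2n -mulr_natl -[t *+ 2]mulr_natl powRM ?ltW//.
  by rewrite invfM mulrACA /l powRB ?powRr1// ?pnatr_eq0 ?implybT.
rewrite !ler_distl => /andP[h1 h2] /andP[h3 h4].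
have h5 : (l - 1) * (c - e) <= (l - 1) * (u t / t `^ theta).
  by rewrite ler_pM2l ?subr_gt0//; lra.
by lra.
Qed.

End limits.

Lemma covariance_error {R : realType} (base a c x y r : R) :
  base - (base + (a * c) ^+ 2 * r - a * (c * x) * (a * (c * y))) =
  (a * c) ^+ 2 * (x * y - r).
Proof. by ring. Qed.

(** Both [x * y] and [r] lie above [x * z], each by at most its own error. Here [x], [y], [z] are
    the moments of order [alpha] at [s], [t], [t - s], and [E] is the decaying exponential. *)
Lemma covariance_error_le {R : realType} (x y z r q m m' C C' E : R) :
  0 <= x -> 0 <= q -> 0 <= m -> 0 <= m' -> 0 <= C -> 0 <= C' -> 0 <= E ->
  z <= y -> y <= z + (q * m + C * E) ->
  x * z <= r -> r <= x * z + (q * m' + C' * E) ->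
  `|x * y - r| <= q * (x * m + m') + (x * C + C') * E.
Proof.
move=> x0 q0 m0 m'0 C0 C'0 E0 zy yz xzr rxz.
have := ler_wpM2l x0 zy; have := ler_wpM2l x0 yz => h1 h2.
have p1 : 0 <= q * (x * m) by rewrite !mulr_ge0.
have p2 : 0 <= q * m' by rewrite mulr_ge0.
have p3 : 0 <= x * C * E by rewrite !mulr_ge0.
have p4 : 0 <= C' * E by rewrite mulr_ge0.
by rewrite ler_norml; apply/andP; split; lra.
Qed.

(** The term [s2 * (c * x)], due to the randomness of the jumps, is positive; the remaining terms
    add up to something nonnegative, by [c^2 * x^2 <= b * y]. *)
Lemma variance_gt0 {R : realType} (s1 s2 c b x y : R) :
  0 < s2 -> 0 < c -> 0 < x -> c ^+ 2 < b -> x ^+ 2 <= y ->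
  0 < s2 * (c * x) + s1 ^+ 2 * (b * y) - s1 * (c * x) * (s1 * (c * x)).
Proof.
move=> s20 c0 x0 cb xy; have h1 : 0 < s2 * (c * x) by rewrite !mulr_gt0.
have h3 : c ^+ 2 * x ^+ 2 <= b * y by apply: ler_pM; rewrite ?sqr_ge0// ltW.
have h4 : s1 ^+ 2 * (c ^+ 2 * x ^+ 2) <= s1 ^+ 2 * (b * y) by rewrite ler_wpM2l ?sqr_ge0.
by lra.
Qed.

Lemma variance_rescale {R : realType} (s1 s2 c b x y p : R) : p != 0 ->
  s2 * c * (x / p) * p^-1 +
    s1 ^+ 2 * (b * (y / p ^+ 2) - c ^+ 2 * (x / p * (x / p))) =
  (s2 * (c * x) + s1 ^+ 2 * (b * y) - s1 * (c * x) * (s1 * (c * x))) / p ^+ 2.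
Proof. by move=> p0; field. Qed.

Lemma correlation_rescale {R : realType} (v a w p : R) :
  v / (a * (p^-1 * w)) = v / (a * w) * p.
Proof. by rewrite !invfM invrK; ring. Qed.

(** * Variance, covariance and correlation for large times *)

Section correlation_limit.
Context {R : realType} d (T : measurableType d) (P : probability T R).
Variables (k : nat) (lambda : 'I_k -> R) (alpha theta k1 k2 : R) (f : R -> R).
Variables (D M : R -> {RV P >-> R}).
Hypotheses (k_gt0 : (0 < k)%N) (lambda_gt0 : forall j, 0 < lambda j).
Hypotheses (alpha_gt0 : 0 < alpha) (alpha_lt1 : alpha < 1).
Hypothesis subD : subordinator f D.
Hypothesis finite_moments : forall r t : R, 0 < r -> 0 <= t ->
  ('E_P[(fun w => D t w `^ r)%R] < +oo)%E.
Hypothesis fractionalM : generalized_fractional_counting_process alpha lambda M.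
Hypothesis indep : independent_processes P (fun t => M t) (fun t => D t).
Hypotheses (theta_gt0 : 0 < theta) (k1_gt0 : 0 < k1) (k2_ge : k1 ^+ 2 <= k2).
Hypothesis moment1 : power_moment D alpha t / t `^ theta @[t --> +oo] --> k1.
Hypothesis moment2 :
  power_moment D (2 * alpha) t / t `^ (2 * theta) @[t --> +oo] --> k2.

Let Z := time_change (fun t => M t) (fun t => D t).
Let S1 := jump_moment lambda 1.
Let S2 := jump_moment lambda 2.
Let mom := power_moment D.

Let countM : counting_process (fun t => M t).
Proof.
by have := fractionalM; rewrite /generalized_fractional_counting_process lt_eqF// => -[].
Qed.

Let D_ge0 t w : 0 <= t -> 0 <= D t w := subordinator_ge0 subD w.

Let mZ t : 0 <= t -> measurable_fun setT (Z t).
Proof. by move=> t0; exact: (measurable_counting_time_change countM). Qed.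

Let Z_ge0 t w : 0 <= t -> 0 <= Z t w.
Proof. by move=> t0; apply: (counting_process_ge0 countM); exact: D_ge0. Qed.

Let covZ s t ms mt r : 0 <= s -> 0 <= t ->
  (\int[P]_w (Z s w)%:E = ms%:E)%E -> (\int[P]_w (Z t w)%:E = mt%:E)%E ->
  (\int[P]_w (Z s w * Z t w)%:E = r%:E)%E ->
  covariance P (Z s) (Z t) = (r - ms * mt)%:E.
Proof.
move=> s0 t0; apply: covariance_ge0E; [exact: mZ|exact: mZ| |] => w; exact: Z_ge0.
Qed.

(** The positive limit [k1] provides one time at which the moment is positive, from which both
    claims follow. *)
Let exponent_gt0 : 0 < f 1 /\ forall t, 0 < t -> 0 < mom alpha t.
Proof.
have [A [_ HA]] := cvgr_gt _ moment1 _ k1_gt0.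
pose t := Num.max A 0 + 1.
have t0 : 0 < t by rewrite ltr_wpDl// le_max lexx orbT.
have At : A < t by rewrite (@le_lt_trans _ _ (Num.max A 0)) ?le_max ?lexx// ltrDl.
have tt0 := powR_gt0 theta t0.
have mt : 0 < power_moment D alpha t.
  by rewrite -[ltRHS](divfK (lt0r_neq0 tt0)) mulr_gt0//; exact: HA _ At.
split; first exact: (laplace_exponent_gt0 subD finite_moments (ltW t0) alpha_gt0 mt).
exact: (power_moment_gt0 subD finite_moments (ltW t0) alpha_gt0 mt).
Qed.

Lemma correlation_equiv (s : R) : 0 < s -> exists2 c : R, 0 < c &
  (fun t => correlation P (Z s) (Z t)) ~_(pinfty_nbhs R)
  (fun t => c * t `^ (- theta)).
Proof.
move=> s_gt0; have s0 := ltW s_gt0; have [f1_gt0 mom_gt0] := exponent_gt0.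
have [c [b [c0 cb EZ EZZ EZst]]] := subordinated_moments k_gt0 lambda_gt0 alpha_gt0
  alpha_lt1 subD finite_moments fractionalM indep.
have S1_gt0 : 0 < S1 by exact: jump_moment_gt0.
have S2_gt0 : 0 < S2 by exact: jump_moment_gt0.
have mom0 r t : 0 <= mom r t by exact: power_moment_ge0.
have b_gt0 : 0 < b by apply: le_lt_trans cb; exact: sqr_ge0.
pose V t := S2 * (c * mom alpha t) + S1 ^+ 2 * (b * mom (2 * alpha) t) -
  (S1 * (c * mom alpha t)) * (S1 * (c * mom alpha t)).
have varE t : 0 <= t -> fine 'V_P[Z t]%E = V t.
  by move=> t0; rewrite /variance (covZ t0 t0 (EZ t t0) (EZ t t0) (EZZ t t0)).
have Vs_gt0 : 0 < V s.
  apply: variance_gt0 => //; first exact: mom_gt0.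
  exact: (power_moment_sqr_le finite_moments).
(* Positivity rests on [b * k2 >= b * k1^2 > c^2 * k1^2], where the strictness comes from
   [c^2 < b]. *)
pose Vinf := S1 ^+ 2 * (b * k2 - c ^+ 2 * k1 ^+ 2).
have Vinf_gt0 : 0 < Vinf.
  rewrite mulr_gt0 ?exprn_gt0// subr_gt0.
  apply: (@lt_le_trans _ _ (b * k1 ^+ 2)); first by rewrite ltr_pM2r ?exprn_gt0.
  by rewrite ler_pM2l.
have cvg_var : V t / (t `^ theta) ^+ 2 @[t --> +oo] --> Vinf.
  (* The term with [S2] grows like [t^theta] only, so that it keeps a factor [1 / t^theta] after
     division by [t^(2 theta)] and disappears in the limit. *)
  have cvgU : S2 * c * (mom alpha t / t `^ theta) * (t `^ theta)^-1 +
      S1 ^+ 2 * (b * (mom (2 * alpha) t / t `^ (2 * theta)) -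
        c ^+ 2 * (mom alpha t / t `^ theta * (mom alpha t / t `^ theta)))
      @[t --> +oo] --> S2 * c * k1 * 0 + S1 ^+ 2 * (b * k2 - c ^+ 2 * (k1 * k1)).
    apply: cvgD.
      apply: cvgM; last exact: cvg_powRN_pinfty.
      by apply: cvgM; [exact: cvg_cst|exact: moment1].
    apply: cvgM; first exact: cvg_cst.
    apply: cvgB; apply: cvgM; try exact: cvg_cst; first exact: moment2.
    by apply: cvgM; exact: moment1.
  rewrite mulr0 add0r -expr2 in cvgU; apply: cvg_trans cvgU.
  apply: near_eq_cvg; apply: filterS (nbhs_pinfty_gt (num_real 0)) => t t0.
  rewrite [2 * theta]mulrC powRrM powR_mulrn ?powR_ge0//.
  by apply: variance_rescale; rewrite gt_eqF// powR_gt0.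
(* [base] is the part of the mixed moment that does not depend on [t]; the remaining part cancels in
   the limit against the product of the means. *)
pose base := S2 * (c * mom alpha s) + S1 ^+ 2 * (b / 2 * mom (2 * alpha) s).
have base_gt0 : 0 < base.
  rewrite ltr_pwDl ?mulr_gt0 ?mom_gt0//.
  by rewrite mulr_ge0 ?sqr_ge0// mulr_ge0// divr_ge0// ltW.
have S1c_gt0 : 0 < (S1 * c) ^+ 2 by rewrite exprn_gt0// mulr_gt0.
have cvg_cov : fine (covariance P (Z s) (Z t)) @[t --> +oo] --> base.
  apply: (@cvg_exp_bound _ _ _ (f 1) s f1_gt0) => e e0.
  (* [Q] bounds the factor that multiplies the precision in the covariance error, so that the
     precision [e / Q] yields [e]; the added 1 makes [Q] positive. *)
  pose Q := (S1 * c) ^+ 2 * (mom alpha s * mom 1 s + mom (alpha + 1) s) + 1.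
  have Q_gt0 : 0 < Q.
    have q0 : 0 <= mom alpha s * mom 1 s + mom (alpha + 1) s by rewrite addr_ge0// mulr_ge0.
    by rewrite ltr_wpDl// mulr_ge0// ltW.
  have eQ : 0 < e / Q by rewrite divr_gt0.
  have [C0 C00 H0] := power_moment_increment_le alpha_gt0 alpha_lt1 subD finite_moments s0 eQ.
  have [C1 C10 H1] := power_moment_mixed_le alpha_gt0 alpha_lt1 subD finite_moments s0 eQ.
  exists ((S1 * c) ^+ 2 * (mom alpha s * C0 + C1)) => t st.
  have t0 := le_trans s0 st; have ts0 : 0 <= t - s by rewrite subr_ge0.
  have [r Er [r1 r2]] := EZst s t s0 st.
  rewrite (covZ s0 t0 (EZ s s0) (EZ t t0) Er) /= -/base.
  have r3 := le_trans r2 (H1 t st); rewrite lee_fin in r3.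
  have := H0 t st; rewrite -/mom in r1 r3 * => h0.
  have a_nd : mom alpha (t - s) <= mom alpha t.
    by apply: (power_moment_nd subD finite_moments) => //; rewrite gerBl.
  have ex0 : 0 <= expR (- t * f 1) by exact: expR_ge0.
  rewrite (covariance_error base S1 c (mom alpha s) (mom alpha t) r).
  rewrite normrM (ger0_norm (ltW S1c_gt0)).
  have bound := covariance_error_le (mom0 alpha s) (ltW eQ) (mom0 1 s)
    (mom0 (alpha + 1) s) C00 C10 ex0 a_nd h0 r1 r3.
  have := ler_wpM2l (ltW S1c_gt0) bound => /le_trans; apply.
  rewrite mulrDr [X in _ + X]mulrA lerD2r mulrCA -[leRHS](divfK (lt0r_neq0 Q_gt0)).
  by rewrite ler_pM2l// lerDl.
pose cs := base / (Num.sqrt (V s) * Num.sqrt Vinf).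
have cs_gt0 : 0 < cs by rewrite divr_gt0// mulr_gt0 ?sqrtr_gt0.
exists cs => //; apply: cvg_equiv_powR; first by rewrite gt_eqF.
have cvg_sd : Num.sqrt (V t / (t `^ theta) ^+ 2) @[t --> +oo] --> Num.sqrt Vinf.
  by apply: continuous_cvg; [exact: sqrt_continuous|exact: cvg_var].
have cvgQ : fine (covariance P (Z s) (Z t)) / (Num.sqrt (V s) *
    Num.sqrt (V t / (t `^ theta) ^+ 2)) @[t --> +oo] --> cs.
  apply: cvgM; first exact: cvg_cov.
  apply: cvgV; first by rewrite gt_eqF// mulr_gt0 ?sqrtr_gt0.
  by apply: cvgM; [exact: cvg_cst|exact: cvg_sd].
apply: cvg_trans cvgQ; apply: near_eq_cvg.
apply: filterS (nbhs_pinfty_gt (num_real 0)) => t t0.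
have tt0 : 0 < t `^ theta by rewrite powR_gt0.
rewrite /correlation !varE ?ltW// powRN invrK [V t / _]mulrC -exprVn.
rewrite sqrtrM ?sqr_ge0// sqrtr_sqr ger0_norm ?invr_ge0 ?(ltW tt0)//.
exact: correlation_rescale.
Qed.

End correlation_limit.

Theorem theorem4p4 (R : realType) (d : measure_display) (T : measurableType d)
    (P : probability T R) (k : nat) (lambda : 'I_k -> R)
    (alpha theta k1 k2 : R) (f : R -> R) (D M : R -> {RV P >-> R})
    (hk : (1 <= k)%N)
    (hlambda : forall j : 'I_k, 0 < lambda j)
    (halpha : 0 < alpha <= 1)
    (hD : levy_subordinator f D)
    (hmoments : forall r t : R, 0 < r -> 0 <= t ->
       ('E_P[(fun w => D t w `^ r)%R] < +oo)%E)
    (hM : generalized_fractional_counting_process alpha lambda M)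
    (hMD : independent_processes P (fun t => M t) (fun t => D t))
    (htheta : 0 < theta < 1)
    (hk1 : 0 < k1)
    (hk2 : k1 ^+ 2 <= k2)
    (hD1 : (fun t : R =>
              fine 'E_P[(fun w => D t w `^ alpha)%R]%E)
           ~_(pinfty_nbhs R)
           (fun t : R => k1 * t `^ theta))
    (hD2 : (fun t : R =>
              fine 'E_P[(fun w => D t w `^ (2 * alpha))%R]%E)
           ~_(pinfty_nbhs R)
           (fun t : R => k2 * t `^ (2 * theta))) :
  long_range_dependence P (time_change (fun t => M t) (fun t => D t)).
Proof.
have [/andP[alpha_gt0 alpha_le1] /andP[theta_gt0 theta_lt1]] := (halpha, htheta).
have [subD _] := hD.
have momE r : (fun t : R => fine 'E_P[(fun w => D t w `^ r)%R]%E) = power_moment D r.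
  by apply/funext => t; rewrite unlock.
rewrite (momE alpha) in hD1; rewrite (momE (2 * alpha)) in hD2.
have moment1 := equiv_powR_cvg hD1; have moment2 := equiv_powR_cvg hD2.
(* For [alpha = 1] the mean of [D t] is linear in [t], so that [theta < 1] is
   impossible. *)
have alpha_lt1 : alpha < 1.
  rewrite lt_neqAle alpha_le1 andbT; apply/negP => /eqP alpha1; subst alpha.
  have := @linear_not_equiv_powR _ (power_moment D 1) theta k1 theta_lt1 hk1.
  by apply => // t t0; exact: (power_moment1D subD hmoments).
exists theta; first by rewrite theta_gt0.
move=> s s0; exact: (correlation_equiv hk hlambda alpha_gt0 alpha_lt1 subD
  hmoments hM hMD theta_gt0 hk1 hk2 moment1 moment2).
Qed.
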